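(* Let the graph $(\mathsf L,\mathsf E)$, the standard Borel space $\Xi$, the function $h$ and the matrices $\kappa$ and $c$ be fixed as in the context, and let $$K_* = \max\left\{\frac{4 \Delta^{\chi+1}}{\bar{c}(1 - \bar{\kappa})}\,;\ \frac{2 \Delta^{\chi+1} \left(2 \Delta^{\chi-1} +1-\bar{c} \Delta^\chi\right)}{(1-\bar{\kappa})^2\left( 1- \bar{c} \Delta^\chi\right)}\right\}.$$ Let $K>K_*$ and $\pi\in\Pi(h,K,\kappa,c)$, and suppose that $\mathcal M(\pi,h)$ is nonempty and hence consists of a single state $\mu$. Then there exist positive $C_K$ and $\alpha_K$, dependent on $K$ only (the graph, $h$, $\kappa$, $c$ being fixed), such that for any two distinct vertices $\ell_1,\ell_2\in\mathsf L$ and any bounded functions $f,g:X\to\mathbb R_+$ such that $f$ is $\mathcal B(\Xi_{\ell_1})$-measurable and $g$ is $\mathcal B(\Xi_{\ell_2})$-measurable, $$|\mathrm{Cov}_\mu(f;g)|\le C_K\|f\|_\infty\|g\|_\infty\exp\left[-\alpha_K\,\delta(\ell_1,\ell_2)\right],$$ where $\mathrm{Cov}_\mu(f;g)=\mu(fg)-\mu(f)\mu(g)$, $\delta$ is the path distance on the graph and $\|\cdot\|_\infty$ is the sup-norm on $X$.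
   Context: Graph: $(\mathsf L,\mathsf E)$ is a countable simple connected graph; $\partial\ell$ is the set of vertices adjacent to $\ell$, $\Delta:=\sup_{\ell}|\partial\ell|<\infty$, and $\chi$ is the chromatic number of the graph. It is a standing fact/assumption that $\chi\le\Delta$ (in particular $\Delta\ge 2$). Spins: $(\Xi,\mathcal B(\Xi))$ is a standard Borel space, $\Xi_\ell$ ($\ell\in\mathsf L$) are copies of $\Xi$, and $X=\Xi^{\mathsf L}$ carries the product $\sigma$-field $\mathcal B(X)$. A function on $X$ is $\mathcal B(\Xi_\ell)$-measurable if it is a measurable function of $x_\ell$ alone. $\mathcal P(E)$ denotes the set of probability measures on a measurable space $E$; $\mu(f)=\int f\,d\mu$. $\mathcal F_\ell$ is the $\sigma$-field $\mathcal B(\Xi^{\mathsf L\setminus\{\ell\}})$, viewed as the sub-$\sigma$-field of $\mathcal B(X)$ generated by the coordinates $x_{\ell'}$, $\ell'\ne\ell$. For $\sigma,\varsigma\in\mathcal P(\Xi)$, $d(\sigma,\varsigma)=\sup_{A\in\mathcal B(\Xi)}|\sigma(A)-\varsigma(A)|$. For $\xi,\eta\in\Xi$, $\upsilon(\xi,\eta)=0$ if $\xi=\eta$ and $1$ otherwise. One-site specification: a family $\pi=\{\pi_\ell\}_{\ell\in\mathsf L}$, $\pi_\ell=\{\pi_\ell^x:x\in X\}\subset\mathcal P(\Xi_\ell)$, such that $x\mapsto\pi_\ell^x(A)$ is $\mathcal F_\ell$-measurable for each $A\in\mathcal B(\Xi_\ell)$. Moreover $\pi_\ell^x$ depends on $x$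 only through $(x_{\ell'})_{\ell'\in\partial\ell}$. A measure $\mu\in\mathcal P(X)$ is consistent with $\pi$ if for every $\ell\in\mathsf L$ the conditional distribution of $x_\ell$ under $\mu$ given $\mathcal F_\ell$ is $\pi_\ell^x$ for $\mu$-almost all $x$; equivalently, $\mu(A)=\int_X\int_\Xi \mathbb I_A(\xi\times y_{\{\ell\}^c})\,\pi_\ell^y(d\xi)\,\mu(dy)$ for all $\ell$ and $A\in\mathcal B(X)$, where $\xi\times y_{\{\ell\}^c}$ is the configuration equal to $\xi$ at $\ell$ and to $y$ elsewhere. $\mathcal M(\pi)$ is the set of all such $\mu$. Fixed data: a measurable function $h:\Xi\to[0,+\infty)$; a matrix $\kappa=(\kappa_{\ell\ell'})$ with $\kappa_{\ell\ell'}\ge0$ and $\bar\kappa:=\sup_\ell\sum_{\ell'\in\partial\ell}\kappa_{\ell\ell'}<1$; a matrix $c=(c_{\ell\ell'})$ with $c_{\ell\ell'}\ge 0$ and $0<\bar c:=\sup_\ell\sum_{\ell'\in\partial\ell}c_{\ell\ell'}<1/\Delta^\chi$. The class $\Pi(h,K,\kappa,c)$, $K>0$: the set of one-site specifications $\pi$ such that for each $\ell\in\mathsf L$: (i) $d(\pi_\ell^x,\pi_\ell^y)\le\sum_{\ell'\in\partial\ell}\kappa_{\ell\ell'}\upsilon(x_{\ell'},y_{\ell'})$ for all $x,y\in X_\ell(h,K):=\{x\in X: h(x_{\ell'})\le K\ \text{for all}\ \ell'\in\partial\ell\}$; (ii) $\pi_\ell^x(h):=\int_\Xi h\,d\pi_\ell^x\le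 1+\sum_{\ell'\in\partial\ell}c_{\ell\ell'}h(x_{\ell'})$ for all $x\in X$. $\mathcal M(\pi,h)$ is the set of $\mu\in\mathcal M(\pi)$ with $\sup_{\ell\in\mathsf L}\int_X h(x_\ell)\,\mu(dx)<\infty$. *)

(* Defs.v *)
From HB Require Import structures.
From mathcomp Require Import all_boot all_order all_algebra.
From mathcomp Require Import all_classical all_reals all_analysis.
From mathcomp Require Import measurable_realfun.
Import Order.TTheory GRing.Theory Num.Theory.
Import numFieldNormedType.Exports.

Set Implicit Arguments.
Unset Strict Implicit.
Unset Printing Implicit Defensive.

Local Open Scope classical_set_scope.
Local Open Scope ring_scope.

(** * Graphs, given by a symmetric irreflexive adjacency relation *)

Definition is_least (P : nat -> Prop) (n : nat) : Prop :=
  P n /\ forall m, P m -> (n <= m)%N.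

Section Graph.
Variables (L : countType) (e : rel L).

Definition nbrs (l : L) : set L := [set l' | e l l'].

Definition walk_of_length (l1 l2 : L) (n : nat) : Prop :=
  exists p : seq L, [/\ path e l1 p, last l1 p = l2 & size p = n].

Definition connected_graph : Prop :=
  forall l1 l2, exists n, walk_of_length l1 l2 n.

(* The supremum of the degrees. As the degrees are natural numbers, their
   supremum, when finite, is their least upper bound in nat; in particular
   [is_max_degree D] forces every neighbourhood to be finite. *)
Definition is_max_degree : nat -> Prop :=
  is_least (fun D => forall l, (nbrs l #<= `I_D)%card).

Definition proper_colouring (k : nat) (col : L -> 'I_k) : Prop :=
  forall l l', e l l' -> col l != col l'.

Definition is_chromatic_number : nat -> Prop :=
  is_least (fun k => exists col : L -> 'I_k, proper_colouring col).

Definition graph_dist (l1 l2 : L) : nat :=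
  xget 0%N [set n | is_least (walk_of_length l1 l2) n].

(* Taken in \bar R, because the supremum of an unbounded set of reals is 0
   by convention. *)
Definition row_sum_sup (R : realType) (a : L -> L -> R) : \bar R :=
  ereal_sup (range (fun l => (\sum_(l' \in nbrs l) a l l')%:E)).

End Graph.

(** * Measurable spaces *)

(* Up to a bijection, the measurable sets are the Borel sets of a separable
   complete metric space. *)
Definition standard_borel (R : realType) (d : measure_display)
    (Xi : measurableType d) : Prop :=
  exists (P : completePseudoMetricType R) (phi : Xi -> P),
    [/\ hausdorff_space P,
        exists2 D : set P, countable D & dense D,
        bijective phi &
        @measurable d Xi = preimage_set_system setT phi <<s @open P >>].

Section Configurations.
Variables (L : countType) (d : measure_display) (Xi : measurableType d).

Definition cylinders (S : set L) : set_system (L -> Xi) :=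
  \bigcup_(l in S) preimage_set_system setT (fun x => x l) measurable.

(* X with the product sigma-algebra, and X with the sub-sigma-algebra F_l
   generated by the coordinates other than l: both are L -> Xi as types. *)
Definition config := g_sigma_algebraType (cylinders setT).
Definition config_off (l : L) := g_sigma_algebraType (cylinders [set~ l]).

End Configurations.
Arguments config L {d} Xi.
Arguments config_off {L d} Xi l.

(* The supremum over measurable sets only: the values of a measure on
   non-measurable sets are meaningless. *)
Definition tv_dist (R : realType) (d : measure_display) (E : measurableType d)
    (mu nu : probability E R) : \bar R :=
  ereal_sup [set `|mu A - nu A|%E | A in measurable].

Definition upsilon (R : realType) (E : choiceType) (xi eta : E) : R :=
  (xi != eta)%:R.

(** * One-site specifications *)

Section Specifications.
Variables (R : realType) (L : countType) (e : rel L).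
Variables (d : measure_display) (Xi : measurableType d).
Implicit Types (pi : L -> config L Xi -> probability Xi R).
Implicit Types (mu : probability (config L Xi) R) (h : Xi -> R).
Implicit Types (kappa c : L -> L -> R).

Record one_site_specification pi : Prop := OneSiteSpecification {
  spec_measurable : forall l (A : set Xi), measurable A ->
    measurable_fun setT (fun x : config_off Xi l => pi l x A);
  spec_local : forall l (x y : config L Xi),
    (forall l', e l l' -> x l' = y l') ->
    forall A : set Xi, measurable A -> pi l x A = pi l y A }.

Definition consistent pi mu : Prop :=
  forall l (A : set (config L Xi)), measurable A ->
    mu A = (\int[mu]_y \int[pi l y]_xi
              (\1_A (dfwith (y : L -> Xi) l xi))%:E)%E.

Definition bounded_nbhd h (K : R) (l : L) : set (config L Xi) :=
  [set x | forall l', e l l' -> h (x l') <= K].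

Record spec_class h (K : R) kappa c pi : Prop := SpecClass {
  spec_class_spec : one_site_specification pi;
  spec_class_contraction : forall l (x y : config L Xi),
    bounded_nbhd h K l x -> bounded_nbhd h K l y ->
    (tv_dist (pi l x) (pi l y) <=
      (\sum_(l' \in nbrs e l) kappa l l' * upsilon R (x l') (y l'))%:E)%E;
  spec_class_growth : forall l (x : config L Xi),
    (\int[pi l x]_xi (h xi)%:E <=
      (1 + \sum_(l' \in nbrs e l) c l l' * h (x l'))%:E)%E }.

Definition tempered_states pi h : set (probability (config L Xi) R) :=
  [set mu | consistent pi mu /\
    (ereal_sup (range (fun l : L => \int[mu]_x (h (x l))%:E)) < +oo)%E].

Definition depends_on_site (l : L) (f : config L Xi -> R) : Prop :=
  exists2 F : Xi -> R, measurable_fun setT F & forall x, f x = F (x l).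

Definition sup_norm (f : config L Xi -> R) : R :=
  sup (range (fun x => `|f x|)).

Definition Cov mu (f g : config L Xi -> R) : R :=
  \int[mu]_x (f x * g x) - (\int[mu]_x f x) * (\int[mu]_x g x).

End Specifications.

Definition K_star (R : realType) (Delta chi : nat) (kbar cbar : R) : R :=
  Num.max
    (4 * Delta%:R ^+ chi.+1 / (cbar * (1 - kbar)))
    (2 * Delta%:R ^+ chi.+1 *
       (2 * Delta%:R ^+ chi.-1 + 1 - cbar * Delta%:R ^+ chi) /
     ((1 - kbar) ^+ 2 * (1 - cbar * Delta%:R ^+ chi))).

(* Main.v *)
Require Import Defs.
From HB Require Import structures.
From mathcomp Require Import all_boot all_order all_algebra.
From mathcomp Require Import all_classical all_reals all_analysis.
From mathcomp Require Import measurable_realfun.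
From mathcomp Require Import ring lra.
Import Order.TTheory GRing.Theory Num.Theory.
Import numFieldNormedType.Exports.

Set Implicit Arguments.
Unset Strict Implicit.
Unset Printing Implicit Defensive.

Local Open Scope classical_set_scope.
Local Open Scope ring_scope.

(** Averaging a function over the spin at a site [l], conditionally on the
    other spins, leaves its covariance with functions of [x l1] unchanged as
    long as [l <> l1]. Starting from a function [g] of [x l2], one averages
    over colour classes, chi classes making up a sweep, until the sites
    involved reach [l1]. Along the way, for the current average [u],
    [`|u x - u y|] is kept below a finite positive combination of the terms
      [1 (x k != y k)]   and   [1 (x k != y k) * (h (x k') + h (y k'))].
    One average at [k] replaces the first term by
      [sum_i kappa k i 1 (x i != y i)
         + K^-1 sum_ij 1 (x i != y i) (h (x j) + h (y j))],
    by the contraction hypothesis if all the neighbouring spins satisfy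
    [h <= K] and by Chebyshev's trick otherwise; the growth hypothesis handles
    [h (x k') + h (y k')]. Since averaging at [k] inside a term of the second
    kind costs a factor Delta, a sweep multiplies the terms of the second kind
    by [cbar * Delta ^ chi < 1], up to terms of the first kind; for [K] above
    [K_star] a suitably weighted combination contracts at each sweep. After
    about [graph_dist l1 l2 / chi] sweeps the oscillation of [u] is
    exponentially small, and so is the covariance. *)

(** * Comparing integrals under two nearby probability measures *)

Section ProbabilityIntegrals.
Context {R : realType} {d : measure_display} {T : measurableType d}.
Implicit Types (P sigma tau : probability T R) (f g h v w : T -> R).
Implicit Types (a b c A B C D : R).

Lemma integrable_dominated P f g : measurable_fun setT f ->
  P.-integrable setT (EFin \o g) -> (forall x, `|f x| <= g x) ->
  P.-integrable setT (EFin \o f).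
Proof.
move=> mf ig fg; apply: le_integrable ig => //; first exact/measurable_EFinP.
by move=> x _ /=; rewrite lee_fin (le_trans (fg x))// ler_norm.
Qed.

Lemma integrable_affine P h a b : measurable_fun setT h ->
  (forall x, 0 <= h x) -> (\int[P]_x (h x)%:E < +oo)%E ->
  P.-integrable setT (EFin \o (fun x => a + b * h x)).
Proof.
move=> mh h0 hoo.
have ih : P.-integrable setT (EFin \o h).
  apply/integrableP; split; first exact/measurable_EFinP.
  by under eq_integral do rewrite /= ger0_norm//.
have -> : EFin \o (fun x => a + b * h x) =
    (cst a%:E) \+ (fun x => b%:E * (h x)%:E)%E.
  by apply/funext => x /=.
apply: integrableD => //; last exact: integrableZl.
exact: finite_measure_integrable_cst.
Qed.

Lemma Rintegral_affine P h a b : measurable_fun setT h ->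
  (forall x, 0 <= h x) -> (\int[P]_x (h x)%:E < +oo)%E ->
  \int[P]_x (a + b * h x) = a + b * \int[P]_x h x.
Proof.
move=> mh h0 hoo.
have ih : P.-integrable setT (EFin \o h).
  by have := integrable_affine 0 1 mh h0 hoo; under [EFin \o _]eq_fun do
    rewrite add0r mul1r.
rewrite RintegralD//; last 2 first.
- exact: finite_measure_integrable_cst.
- by have := integrable_affine 0 b mh h0 hoo; under [EFin \o _]eq_fun do
    rewrite add0r.
by rewrite Rintegral_cst// [X in fine X](@probability_setT _ _ _ P) mulr1
  RintegralZl.
Qed.

(** Layer-cake formula: each integral is the integral over [r >= 0] of the probability of [w > r].
    The tail under [sigma] exceeds the one under [tau] by at most [D] for [r <= A], and vanishes
    beyond [A]. *)
Lemma le_Rintegral_total_variation sigma tau w A D : measurable_fun setT w ->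
  (forall x, 0 <= w x <= A) -> 0 <= D ->
  (forall E, measurable E -> (sigma E <= tau E + D%:E)%E) ->
  \int[sigma]_x w x <= \int[tau]_x w x + A * D.
Proof.
move=> mw w0A D0 sD.
have A0 : 0 <= A by have /andP[/le_trans] := w0A point; apply.
pose X : {mfun T >-> R} := HB.pack w (isMeasurableFun.Build _ _ _ _ w mw).
have EX (P : probability T R) :
    (\int[P]_x (w x)%:E =
      \int[lebesgue_measure]_(r in `[0%R, +oo[) ccdf (X : {RV P >-> R}) r)%E.
  rewrite -ge0_expectation_ccdf; first by rewrite unlock.
  by move=> x; have /andP[] := w0A x.
have iw (P : probability T R) : P.-integrable setT (EFin \o w).
  apply: (@integrable_dominated P w (cst A)) => //;
    first exact: finite_measure_integrable_cst.
  by move=> x; have /andP[? ?] := w0A x; rewrite ger0_norm.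
have Iw (P : probability T R) : (\int[P]_x w x)%:E = (\int[P]_x (w x)%:E)%E.
  rewrite /Rintegral fineK//; exact: (integrable_fin_num measurableT (iw P)).
rewrite -lee_fin EFinD !Iw !EX.
have -> : (A * D)%:E = (\int[lebesgue_measure]_(r in `[0%R, +oo[)
    (D * \1_(`[0%R, A]) r)%:E)%E.
  under eq_integral do rewrite EFinM.
  rewrite ge0_integralZl_EFin//; last first.
    by apply/measurable_EFinP; exact: measurable_indic.
  rewrite integral_indic//= setIidl; last first.
    by move=> r /=; rewrite !in_itv/= => /andP[->].
  by rewrite lebesgue_measure_itv/= lte_fin; case: ltP => [_|A0'];
    rewrite ?sube0 -?EFinD -?EFinM ?subr0 1?mulrC//; congr EFin;
    rewrite (le_anti (introT andP (conj A0 A0'))) ?mul0r ?mulr0.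
rewrite -ge0_integralD//; last 3 first.
- by apply: measurable_funTS; apply: ccdf_measurable.
- by move=> r _; rewrite lee_fin mulr_ge0.
- by apply/measurable_EFinP; apply: measurable_funM => //;
    exact: measurable_indic.
apply: ge0_le_integral => //.
- by apply: measurable_funTS; apply: ccdf_measurable.
- apply: emeasurable_funD; first by apply: measurable_funTS;
    apply: ccdf_measurable.
  by apply/measurable_EFinP; apply: measurable_funM => //;
    exact: measurable_indic.
move=> r /=; rewrite in_itv/= andbT => r0.
have [rA|Ar] := leP r A.
  rewrite indicE mem_set ?mulr1 /=; last by rewrite in_itv/= r0.
  by apply: sD; rewrite -[_ @^-1` _]setTI; exact: (mw measurableT).
rewrite [leLHS](_ : _ = 0%E); first by rewrite adde_ge0// lee_fin mulr_ge0.
rewrite -[RHS](@measure0 _ _ _ sigma) /ccdf /distribution/= /pushforward;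
  congr (_ _).
apply/seteqP; split => x //=; rewrite in_itv/= andbT => rw.
by have /andP[_ wA] := w0A x; have := lt_le_trans (lt_trans Ar rw) wA;
  rewrite ltxx.
Qed.

Lemma Rintegral_norm_le P h v a b : measurable_fun setT v ->
  measurable_fun setT h -> (forall x, 0 <= h x) ->
  (\int[P]_x (h x)%:E < +oo)%E -> (forall x, `|v x| <= a + b * h x) ->
  `|\int[P]_x v x| <= a + b * \int[P]_x h x.
Proof.
move=> mv mh h0 hoo vh.
have iv := integrable_dominated mv (integrable_affine a b mh h0 hoo) vh.
apply: le_trans (le_normr_Rintegral measurableT iv) _.
rewrite -(Rintegral_affine _ _ mh h0 hoo); apply: le_Rintegral => //.
- apply: (integrable_dominated _ (integrable_affine a b mh h0 hoo)) => //.
    exact: measurableT_comp.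
  by move=> x; rewrite normr_id.
- exact: integrable_affine.
Qed.

(* Centring [v] at [m] leaves a part [w] with values in an interval of length
   [A], to which total variation applies, and a remainder bounded by [B * h]. *)
Lemma dist_Rintegral_osc_le sigma tau h v A B C D :
  measurable_fun setT h -> (forall x, 0 <= h x) ->
  (\int[sigma]_x (h x)%:E < +oo)%E -> (\int[tau]_x (h x)%:E < +oo)%E ->
  measurable_fun setT v -> (forall x, `|v x| <= C) ->
  0 <= A -> 0 <= B -> 0 <= D ->
  (forall x y, `|v x - v y| <= A + B * (h x + h y)) ->
  (forall E, measurable E -> (sigma E <= tau E + D%:E)%E) ->
  (forall E, measurable E -> (tau E <= sigma E + D%:E)%E) ->
  `|\int[sigma]_x v x - \int[tau]_x v x| <=
    A * D + B * (\int[sigma]_x h x + \int[tau]_x h x).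
Proof.
move=> mh h0 hs ht mv vC A0 B0 D0 osc st ts.
pose S := range (fun x => v x - B * h x).
have Sub : ubound S C.
  move=> _ [x _ <-]; rewrite (le_trans _ (vC x))// (le_trans _ (ler_norm _))//.
  by rewrite gerBl mulr_ge0.
have supS : has_sup S.
  by split; [exists (v point - B * h point), point|exists C].
(* The oscillation bound gives [v x - B * h x <= m <= v y + A + B * h y]. Hence [v - m + A] lies
   between [- B * h] and [A + B * h], and truncating it to [[0, A]] costs at most [B * h]. *)
pose m := sup S.
have lem x : v x - B * h x <= m by apply: sup_upper_bound => //; exists x.
have gem y : m <= v y + A + B * h y.
  apply: ge_sup; first by case: supS.
  move=> _ [x _ <-]; have := osc x y; rewrite ler_norml => /andP[_].
  by rewrite mulrDr; lra.
pose w x := Num.min (Num.max (v x - m + A) 0) A.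
have mw : measurable_fun setT w.
  apply: measurable_minr => //; apply: measurable_maxr => //.
  by apply: measurable_funD => //; apply: measurable_funB.
have w01 x : 0 <= w x <= A.
  by rewrite /w le_min le_max lexx orbT A0 ge_min lexx orbT.
pose r x := v x - m + A - w x.
have mr : measurable_fun setT r.
  apply: measurable_funB => //.
  by apply: measurable_funD => //; apply: measurable_funB.
have rB x : `|r x| <= 0 + B * h x.
  rewrite add0r /r /w.
  have := lem x; have := gem x; have : 0 <= B * h x by rewrite mulr_ge0.
  move=> Bh g l; rewrite ler_norml.
  clear hs ht.
  case: (leP (v x - m + A) 0) => ?; first by rewrite min_l//; apply/andP;
    split; lra.
  by case: (leP (v x - m + A) A) => ?; apply/andP; split; lra.
have iv P : P.-integrable setT (EFin \o v).
  apply: (@integrable_dominated P v (cst C)) => //.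
  exact: finite_measure_integrable_cst.
have iw P : P.-integrable setT (EFin \o w).
  apply: (@integrable_dominated P w (cst A)) => //;
    first exact: finite_measure_integrable_cst.
  by move=> x; have /andP[? ?] := w01 x; rewrite ger0_norm.
have ic P c : P.-integrable setT (EFin \o cst c) by exact:
  finite_measure_integrable_cst.
have vE P : (\int[P]_x (h x)%:E < +oo)%E ->
    \int[P]_x v x = \int[P]_x w x + \int[P]_x r x + (m - A).
  move=> hP.
  have ir : P.-integrable setT (EFin \o r).
    exact: (integrable_dominated mr (integrable_affine 0 B mh h0 hP) rB).
  rewrite (_ : \int[P]_x v x = \int[P]_x (w x + r x + cst (m - A) x));
    last first.
    by apply: eq_Rintegral => x _ /=; rewrite /r; ring.
  have iwr : P.-integrable setT (EFin \o (fun x => w x + r x)).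
    exact: (integrableD measurableT (iw P) ir).
  rewrite (RintegralD measurableT iwr (ic P _)) (RintegralD measurableT (iw P)
    ir).
  by rewrite Rintegral_cst// [X in fine X](@probability_setT _ _ _ P) mulr1.
have := Rintegral_norm_le mr mh h0 hs rB.
have := Rintegral_norm_le mr mh h0 ht rB.
have := le_Rintegral_total_variation mw w01 D0 st.
have := le_Rintegral_total_variation mw w01 D0 ts.
rewrite !vE// !ler_norml; clear hs ht vE st ts => ? ? /andP[? ?] /andP[? ?].
by apply/andP; split; lra.
Qed.

(** Triangle inequality through the integral of [v2] under [sigma]: first the integrand changes,
    then the measure. *)
Lemma dist_Rintegral_le sigma tau h (v1 v2 : T -> R) a b A B C D :
  measurable_fun setT h -> (forall x, 0 <= h x) ->
  (\int[sigma]_x (h x)%:E < +oo)%E -> (\int[tau]_x (h x)%:E < +oo)%E ->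
  measurable_fun setT v1 -> (forall x, `|v1 x| <= C) ->
  measurable_fun setT v2 -> (forall x, `|v2 x| <= C) ->
  0 <= A -> 0 <= B -> 0 <= D ->
  (forall x, `|v1 x - v2 x| <= a + b * h x) ->
  (forall x y, `|v2 x - v2 y| <= A + B * (h x + h y)) ->
  (forall E, measurable E -> (sigma E <= tau E + D%:E)%E) ->
  (forall E, measurable E -> (tau E <= sigma E + D%:E)%E) ->
  `|\int[sigma]_x v1 x - \int[tau]_x v2 x| <=
    (a + b * \int[sigma]_x h x) +
    (A * D + B * (\int[sigma]_x h x + \int[tau]_x h x)).
Proof.
move=> mh h0 hs ht m1 b1 m2 b2 A0 B0 D0 v12 osc st ts.
have iv v : measurable_fun setT v -> (forall x, `|v x| <= C) ->
    sigma.-integrable setT (EFin \o v).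
  move=> mv vC; apply: (@integrable_dominated sigma v (cst C)) => //.
  exact: finite_measure_integrable_cst.
have := dist_Rintegral_osc_le mh h0 hs ht m2 b2 A0 B0 D0 osc st ts.
have := Rintegral_norm_le (measurable_funB m1 m2) mh h0 hs v12.
rewrite RintegralB//; [|exact: iv|exact: iv].
move=> H1 H2; rewrite -(subrKA (\int[sigma]_x v2 x)).
exact: le_trans (ler_normD _ _) (lerD H1 H2).
Qed.

End ProbabilityIntegrals.

(** * Redrawing one spin as a probability kernel on configurations *)

Section ConfigurationUpdates.
Context {R : realType} {L : countType} {d : measure_display}.
Context {Xi : measurableType d}.
Implicit Types (pi : L -> config L Xi -> probability Xi R).
Implicit Types (mu : probability (config L Xi) R) (u : config L Xi -> R).

Lemma measurable_coord (l : L) :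
  measurable_fun setT (fun x : config L Xi => x l).
Proof.
move=> _ A mA; apply: sub_sigma_algebra.
by exists l => //; exists A.
Qed.

Definition update (l : L) (x : config L Xi) (xi : Xi) : config L Xi :=
  dfwith (x : L -> Xi) l xi.

Lemma updateE (l k : L) x xi : update l x xi k = if k == l then xi else x k.
Proof.
rewrite /update; case: eqP => [->|/eqP kl]; first by rewrite dfwithin.
by rewrite dfwithout// eq_sym.
Qed.

Lemma measurable_update (l : L) :
  measurable_fun setT (fun p : config L Xi * Xi => update l p.1 p.2).
Proof.
apply: (@measurability _ _ _ (config L Xi) _ _ (@cylinders L d Xi setT)) =>
  // _ [_ [k _ [A mA <-]] <-].
rewrite !setTI.
have [->|kl] := eqVneq k l.
  rewrite (_ : _ @^-1` _ = setT `&` snd @^-1` A); first exact: measurable_snd.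
  by rewrite setTI; apply/seteqP; split => p /=; rewrite updateE eqxx.
rewrite (_ : _ @^-1` _ =
  setT `&` fst @^-1` (setT `&` (fun x : config L Xi => x k) @^-1` A)).
  by apply: measurable_fst => //; exact: measurable_coord.
by rewrite !setTI; apply/seteqP; split => p /=; rewrite updateE (negPf kl).
Qed.

Lemma measurable_update_site (l : L) x : measurable_fun setT (update l x).
Proof.
exact: (measurableT_comp (measurable_update l) (pair1_measurable x)).
Qed.

Definition site_average pi (l : L) u (x : config L Xi) : R :=
  \int[pi l x]_xi u (update l x xi).

Section Kernel.
Context (pi : L -> config L Xi -> probability Xi R) (l : L).
Hypothesis mpi : forall A : set Xi, measurable A ->
  measurable_fun setT (fun x : config_off Xi l => pi l x A).

Definition site_kernel (x : config L Xi) : {measure set Xi -> \bar R} := pi l x.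

Let measurable_site_kernel (A : set Xi) : measurable A ->
  measurable_fun setT (site_kernel ^~ A).
Proof.
move=> mA _ B mB; have := mpi mA measurableT mB.
(* Measurability for the sigma-field without the coordinate [l] passes to the product sigma-field,
   which has more cylinders. *)
apply: sub_sigma_algebra2 => _ [k _ [C mC <-]].
by exists k => //; exists C.
Qed.

HB.instance Definition _ :=
  isKernel.Build _ _ _ _ _ site_kernel measurable_site_kernel.

Let site_kernel_prob x : site_kernel x setT = 1%E.
Proof. exact: probability_setT. Qed.

HB.instance Definition _ :=
  Kernel_isProbability.Build _ _ _ _ _ site_kernel site_kernel_prob.

Lemma measurable_site_integral (F : config L Xi -> \bar R) :
  measurable_fun setT F -> (forall x, 0 <= F x)%E ->
  measurable_fun setT (fun x => \int[pi l x]_xi F (update l x xi))%E.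
Proof.
move=> mF F0.
apply: (measurable_fun_integral_finite_kernel
  (fun p : config L Xi * Xi => F (update l p.1 p.2)) site_kernel) => //.
exact: measurableT_comp mF (measurable_update l).
Qed.

Lemma measurable_site_average u : measurable_fun setT u ->
  (forall x, 0 <= u x) -> measurable_fun setT (site_average pi l u).
Proof.
move=> mu_ u0; apply: measurableT_comp => //.
apply: (@measurable_site_integral (EFin \o u)).
  exact/measurable_EFinP.
by move=> x; rewrite lee_fin.
Qed.

(** The law of the configuration after its spin at [l] is redrawn. The [unit] component is there
    because [kcomp] takes as second kernel one whose source is a product, and [mu] is viewed as a
    kernel from [unit]. *)
Definition update_kernel (p : unit * config L Xi) :
    {measure set (config L Xi) -> \bar R} :=
  mkcomp site_kernel (kdirac (measurable_update l)) p.2.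

Let measurable_update_kernel (A : set (config L Xi)) : measurable A ->
  measurable_fun setT (update_kernel ^~ A).
Proof.
move=> mA; apply: (measurableT_comp (f := fun y : config L Xi =>
  mkcomp site_kernel (kdirac (measurable_update l)) y A)) measurable_snd.
exact: measurable_kernel.
Qed.

HB.instance Definition _ :=
  isKernel.Build _ _ _ _ _ update_kernel measurable_update_kernel.

Let update_kernel_prob p : update_kernel p setT = 1%E.
Proof.
rewrite /update_kernel/= /kcomp/=.
under eq_integral do rewrite diracT.
by rewrite integral_cst// mul1e; exact: probability_setT.
Qed.

HB.instance Definition _ :=
  Kernel_isProbability.Build _ _ _ _ _ update_kernel update_kernel_prob.

(** Consistency says that [mu] agrees on sets with its composition with [update_kernel], hence also
    on nonnegative functions; the composed integral then unfolds. *)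
Lemma consistent_integral mu (F : config L Xi -> \bar R) : consistent pi mu ->
  measurable_fun setT F -> (forall x, 0 <= F x)%E ->
  (\int[mu]_x F x = \int[mu]_x \int[pi l x]_xi F (update l x xi))%E.
Proof.
move=> muP mF F0.
pose cmu := kprobability (measurable_cst (mu : pprobability (config L Xi) R) :
  measurable_fun setT (fun _ : unit => _)).
transitivity (\int[kcomp cmu update_kernel tt]_x F x)%E.
  apply: eq_measure_integral => A mA _.
  apply: (etrans (muP l A mA)); rewrite /= /kcomp/=.
  apply: eq_integral => y _; apply: eq_integral => xi _.
  by rewrite /= /dirac indicE.
rewrite integral_kcomp//; apply: eq_integral => y _.
rewrite /update_kernel /mkcomp [LHS]integral_kcomp//;
  apply: eq_integral => xi _.
by rewrite [LHS]integral_dirac// diracT mul1e.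
Qed.

End Kernel.
End ConfigurationUpdates.

(** * Sum bounds, and finite combinations of influence terms *)

Lemma sum_le_size (R : numDomainType) (I : eqType) (s : seq I) (F : I -> R)
    (M : R) n : 0 <= M ->
  (forall i, i \in s -> F i <= M) -> (size s <= n)%N ->
  \sum_(i <- s) F i <= n%:R * M.
Proof.
move=> M0 FM sn; apply: (@le_trans _ _ (\sum_(i <- s) M)).
  by rewrite big_seq [leRHS]big_seq; exact: ler_sum.
by rewrite big_const_seq count_predT iter_addr_0 -[M *+ _]mulr_natl ler_wpM2r//
  ler_nat.
Qed.

Lemma weighted_sum_le (R : numDomainType) (I : eqType) (s : seq I)
    (w F : I -> R) (M W : R) : 0 <= M ->
  (forall i, 0 <= w i) -> (forall i, i \in s -> F i <= M) ->
  \sum_(i <- s) w i <= W -> \sum_(i <- s) w i * F i <= W * M.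
Proof.
move=> M0 w0 FM wW; apply: (@le_trans _ _ (\sum_(i <- s) w i * M)).
  by rewrite big_seq [leRHS]big_seq; apply: ler_sum => i si;
    rewrite ler_wpM2l ?FM.
by rewrite -mulr_suml ler_wpM2r.
Qed.

Section InfluenceTerms.
Context {R : realType} {L : countType}.
Variables (nb : L -> seq L) (kappa c : L -> L -> R) (K : R).
Implicit Types (W : pred L) (Gam : L * option L -> R).
Implicit Types (Th : seq (R * (L * option L))) (t : L * option L).

(* [Gam (k, None)] stands for the indicator of [x k != y k] and
   [Gam (k, Some k')] for this indicator times [h (x k') + h (y k')];
   [transfer W] bounds what these become once the sites in [W], pairwise not
   adjacent, have been averaged over. *)
Definition transfer W Gam t : R :=
  match t with
  | (k, None) =>
    if W k then \sum_(i <- nb k) kappa k i * Gam (i, None) +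
                K^-1 * \sum_(i <- nb k) \sum_(j <- nb k) Gam (i, Some j)
    else Gam (k, None)
  | (k, Some k') =>
    \sum_(i <- if W k then nb k else [:: k])
      if W k' then
        2 * Gam (i, None) + \sum_(j <- nb k') c k' j * Gam (i, Some j)
      else Gam (i, Some k')
  end.

(** The list [Th] encodes a finite combination of terms, each with its coefficient, and [Gam]
    assigns values to the terms. *)
Definition pairing Th Gam : R := \sum_(p <- Th) p.1 * Gam p.2.

Definition transfer_terms W t : seq (R * (L * option L)) :=
  match t with
  | (k, None) =>
    if W k then [seq (kappa k i, (i, None)) | i <- nb k] ++
                [seq (K^-1, (i, Some j)) | i <- nb k, j <- nb k]
    else [:: (1, (k, None))]
  | (k, Some k') =>
    flatten [seq
      if W k' then (2, (i, None)) :: [seq (c k' j, (i, Some j)) | j <- nb k']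
      else [:: (1, (i, Some k'))]
    | i <- if W k then nb k else [:: k]]
  end.

(** The transpose of [transfer W] for [pairing]. The sites involved are followed on the [Th] side,
    while the contraction estimates are made on the [Gam] side. *)
Definition adjoint W Th : seq (R * (L * option L)) :=
  flatten [seq [seq (p.1 * q.1, q.2) | q <- transfer_terms W p.2] | p <- Th].

Lemma pairing_transfer_terms W Gam t :
  pairing (transfer_terms W t) Gam = transfer W Gam t.
Proof.
rewrite /pairing; case: t => k [k'|] /=.
  rewrite big_flatten big_map; apply: eq_bigr => i _.
  case: (W k'); last by rewrite big_seq1 mul1r.
  by rewrite big_cons big_map.
case: (W k); last by rewrite big_seq1 mul1r.
rewrite big_cat/= big_map big_flatten/= big_map mulr_sumr; congr (_ + _).
by apply: eq_bigr => i _; rewrite big_map mulr_sumr.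
Qed.

Lemma pairing_adjoint W Th Gam :
  pairing (adjoint W Th) Gam = pairing Th (transfer W Gam).
Proof.
rewrite /pairing/adjoint big_flatten big_map; apply: eq_bigr => p _.
rewrite big_map -pairing_transfer_terms /pairing mulr_sumr.
by apply: eq_bigr => q _; rewrite mulrA.
Qed.

Lemma le_pairing Th Gam1 Gam2 : (forall p, p \in Th -> 0 <= p.1) ->
  (forall p, p \in Th -> Gam1 p.2 <= Gam2 p.2) ->
  pairing Th Gam1 <= pairing Th Gam2.
Proof.
move=> Th0 le12; rewrite /pairing big_seq [leRHS]big_seq;
  apply: ler_sum => p pTh.
by rewrite ler_wpM2l ?le12 ?Th0.
Qed.

Definition term_sites t : seq L :=
  t.1 :: if t.2 is Some k then [:: k] else [::].

Hypotheses (kappa0 : forall i j, 0 <= kappa i j).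
Hypotheses (c0 : forall i j, 0 <= c i j) (K0 : 0 < K).

Lemma transfer_terms_ge0 W t p : p \in transfer_terms W t -> 0 <= p.1.
Proof.
case: t => k [k'|] /=.
  move=> /flattenP[s /mapP[i _ ->]]; case: (W k').
    rewrite inE => /predU1P[->//|/mapP[j _ ->]//=].
  by rewrite inE => /eqP ->.
case: (W k); last by rewrite inE => /eqP ->.
rewrite mem_cat => /orP[/mapP[i _ ->]//=|/allpairsP[[i j] [_ _ ->]]/=].
by rewrite invr_ge0 ltW.
Qed.

Lemma adjoint_ge0 W Th : (forall p, p \in Th -> 0 <= p.1) ->
  forall p, p \in adjoint W Th -> 0 <= p.1.
Proof.
move=> Th0 p /flattenP[s /mapP[q qTh ->] /mapP[r rt ->]]/=.
apply: mulr_ge0; [exact: Th0|exact: transfer_terms_ge0 rt].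
Qed.

Lemma transfer_terms_sites W t p i :
  p \in transfer_terms W t -> i \in term_sites p.2 ->
  i \in term_sites t \/ exists2 k, k \in term_sites t & i \in nb k.
Proof.
have lft k k' j : j \in (if W k then nb k else [:: k]) ->
    j \in term_sites (k, k') \/
    exists2 m, m \in term_sites (k, k') & j \in nb m.
  case: (W k); first by right; exists k => //; rewrite inE eqxx.
  by rewrite inE => /eqP ->; left; rewrite inE eqxx.
have site1 j : i \in term_sites (j, None) -> i = j by rewrite inE => /eqP.
have site2 j m : i \in term_sites (j, Some m) -> i = j \/ i = m.
  by rewrite !inE => /orP[/eqP|/eqP]; [left|right].
case: t => k [k'|] /=.
  move=> /flattenP[s /mapP[j jk ->]]; case: (W k').
    rewrite inE => /predU1P[->|/mapP[m mk ->]].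
      by move=> /site1 ->; exact: lft.
    move=> /site2[->|->]; first exact: lft.
    by right; exists k' => //; rewrite !inE eqxx orbT.
  rewrite mem_seq1 => /eqP -> /site2[->|->]; first exact: lft.
  by left; rewrite !inE eqxx orbT.
case: (W k); last by rewrite mem_seq1 => /eqP ->; left.
rewrite mem_cat => /orP[/mapP[j jk ->]|/allpairsP[[j m] [/= jk mk ->]]].
  by move=> /site1 ->; right; exists k; rewrite // inE eqxx.
by move=> /site2[->|->]; right; exists k; rewrite // inE eqxx.
Qed.

Definition sites Th : seq L := flatten [seq term_sites p.2 | p <- Th].

(** The sites involved spread by at most one unit of distance per colour, which limits how soon [l1]
    can be reached from [l2]. *)
Lemma sites_adjoint W Th i : i \in sites (adjoint W Th) ->
  i \in sites Th \/ exists2 k, k \in sites Th & i \in nb k.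
Proof.
move=> /flattenP[s /mapP[p /flattenP[s' /mapP[q qTh ->] /mapP[r rt ->]] ->]] /=.
move=> /(transfer_terms_sites rt)[iq|[k kq ik]]; [left|right; exists k => //];
  by apply/flattenP; exists (term_sites q.2) => //; apply: map_f.
Qed.

End InfluenceTerms.

(** * Contraction of the term bounds over a sweep of all colours *)

Section Sweeps.
Context {R : realType} {L : countType}.
Variables (nb : L -> seq L) (kappa c : L -> L -> R) (K : R) (col : L -> nat).
Implicit Types (Gam : L * option L -> R) (Th : seq (R * (L * option L))).

Notation colour j := [pred k | col k == j].

Fixpoint sweep j Gam : L * option L -> R :=
  if j is j'.+1 then transfer nb kappa c K (colour j') (sweep j' Gam) else Gam.

(** Transposition reverses composition: colour [j'] acts first here, and last in [sweep]. *)
Fixpoint sweep_adjoint j Th : seq (R * (L * option L)) :=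
  if j is j'.+1 then sweep_adjoint j' (adjoint nb kappa c K (colour j') Th)
  else Th.

Lemma pairing_sweep_adjoint j Th Gam :
  pairing (sweep_adjoint j Th) Gam = pairing Th (sweep j Gam).
Proof. by elim: j Th => //= j IH Th; rewrite IH pairing_adjoint. Qed.

Lemma pairing_iter_sweep_adjoint n j Th Gam :
  pairing (iter n (sweep_adjoint j) Th) Gam = pairing Th (iter n (sweep j) Gam).
Proof.
by elim: n Gam => //= n IH Gam; rewrite pairing_sweep_adjoint IH -iterSr.
Qed.

Variables (Delta chi : nat) (kbar cbar th g l : R).
Hypotheses (K0 : 0 < K) (kappa0 : forall i j, 0 <= kappa i j).
Hypotheses (c0 : forall i j, 0 <= c i j).
Hypothesis size_nb : forall k, (size (nb k) <= Delta)%N.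
Hypothesis kappa_le : forall k, \sum_(i <- nb k) kappa k i <= kbar.
Hypothesis c_le : forall k, \sum_(i <- nb k) c k i <= cbar.
Hypothesis col_lt : forall k, (col k < chi)%N.
Hypothesis col_nb : forall k i, i \in nb k -> col i != col k.
Hypotheses (Delta1 : (1 <= Delta)%N) (chi2 : (2 <= chi)%N).
Hypotheses (cbar0 : 0 <= cbar) (g0 : 0 <= g) (l0 : 0 <= l) (th1 : th <= 1).
(** Here [g] and [l] bound the terms of the first and of the second kind before a sweep; [th_g] and
    [th_l] are what makes both bounds shrink by the factor [th]. *)
Hypothesis th_g : kbar * g + K^-1 * (Delta%:R ^+ chi * l) <= th * g.
Hypothesis th_l : Delta%:R ^+ chi * (2 * g + cbar * l) <= th * l.

Let D : R := Delta%:R.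

Let D1 : 1 <= D. Proof. by rewrite /D ler1n. Qed.

Let DX1 j : 1 <= D ^+ j. Proof. exact: exprn_ege1. Qed.

Let DX0 j : 0 <= D ^+ j. Proof. exact: le_trans (DX1 j). Qed.

Let gcl0 : 0 <= 2 * g + cbar * l.
Proof. by rewrite addr_ge0// mulr_ge0. Qed.

Let thl_le : th * l <= l. Proof. by rewrite ler_piMl. Qed.

Let gcl_le : 2 * g + cbar * l <= l.
Proof.
apply: le_trans (le_trans th_l thl_le); exact: ler_peMl.
Qed.

Let DXle i j : (i <= j)%N -> D ^+ i <= D ^+ j.
Proof. by move=> ij; rewrite ler_weXn2l. Qed.

(** Multiplied by [D], the left side is at most [th * l <= l], by [th_l]. So at the last colour the
    bound for treated second sites is no worse than the bound [D ^+ (chi - 2) * l] available at the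
    earlier colours. *)
Let last_le : D ^+ chi.-1 * (2 * g + cbar * l) <= D ^+ (chi - 2) * l.
Proof.
have D0 : 0 < D by exact: lt_le_trans D1.
rewrite -(ler_pM2l D0) !mulrA -!exprS prednK; last exact: leq_trans chi2.
apply: le_trans th_l (le_trans thl_le _).
exact: ler_peMl.
Qed.

(* Bounds after the colours below [j] have been treated. The last clause, where
   averaging at [k'] has already brought in [cbar], is needed at the last
   colour: there the sites next to the updated one have all been treated. *)
Definition sweep_bound j Gam : Prop :=
  [/\ forall k, 0 <= Gam (k, None) <= (if (col k < j)%N then th * g else g),
      forall k k', 0 <= Gam (k, Some k') <= D ^+ j * l &
      forall k k', (col k' < j)%N ->
        Gam (k, Some k') <= D ^+ j * (2 * g + cbar * l)].

Lemma sweep_boundS j Gam : (j < chi)%N -> sweep_bound j Gam ->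
  sweep_bound j.+1 (transfer nb kappa c K (colour j) Gam).
Proof.
move=> jchi [gN lS lS'].
have thg_le : th * g <= g by rewrite ler_piMl.
have gam0 k : 0 <= Gam (k, None) by have /andP[] := gN k.
have gamg k : Gam (k, None) <= g.
  by have /andP[_] := gN k; case: ifP => // _ /le_trans; apply.
have lam0 k k' : 0 <= Gam (k, Some k') by have /andP[] := lS k k'.
have laml k k' : Gam (k, Some k') <= D ^+ j * l by have /andP[] := lS k k'.
have size_left (k : L) :
    (size (if col k == j then nb k else [:: k]) <= Delta)%N.
  by case: ifP.
have Dl0 : 0 <= D ^+ j * l by rewrite mulr_ge0.
have Dg0 : 0 <= D ^+ j * (2 * g + cbar * l) by rewrite mulr_ge0.
have inner i k' : col k' = j -> 2 * Gam (i, None) +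
    \sum_(m <- nb k') c k' m * Gam (i, Some m) <= D ^+ j * (2 * g + cbar * l).
  move=> _; rewrite mulrDr; apply: lerD.
    rewrite (@le_trans _ _ (2 * g))// ?ler_wpM2l//.
    by apply: ler_peMl => //; rewrite mulr_ge0.
  rewrite mulrCA; apply: weighted_sum_le => //.
split.
- move=> k /=; case: ifPn => [/eqP kj|kj]; last first.
    rewrite (_ : (col k < j.+1)%N = (col k < j)%N)//.
    by rewrite ltnS leq_eqVlt (negPf kj).
  rewrite kj ltnSn; apply/andP; split.
    rewrite addr_ge0// ?mulr_ge0 ?invr_ge0 ?(ltW K0)//;
      do ?[apply: sumr_ge0 => i _];
      by rewrite ?mulr_ge0// sumr_ge0.
  apply: le_trans th_g; apply: lerD; first exact: weighted_sum_le.
  rewrite ler_wpM2l ?invr_ge0 ?(ltW K0)//.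
  (* Two factors [D] count the pairs of neighbours [i], [m]; each summand must then be at most
     [D ^+ (chi - 2) * l]. *)
  have -> : Delta%:R ^+ chi * l = D * (D * (D ^+ (chi - 2) * l)).
    by rewrite -[in LHS](subnK chi2) addn2 !exprS -!mulrA.
  have M0 : 0 <= D ^+ (chi - 2) * l by rewrite mulr_ge0.
  have DM0 : 0 <= D * (D ^+ (chi - 2) * l).
    by rewrite mulr_ge0// (le_trans _ D1).
  apply: sum_le_size => // i ik; apply: sum_le_size => // m mk.
  have [jlt|jge] := leqP j (chi - 2).
    by apply: le_trans (laml _ _) _; rewrite ler_wpM2r// DXle.
  have jE : j = chi.-1.
    move: chi2 jchi jge; case: (chi) => [|[|n]]// _.
    rewrite ltnS subn2/= => ? ?.
    by apply/eqP; rewrite eqn_leq; apply/andP.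
  (* At the last colour every neighbour [m] of [k] has a smaller colour, so the clause with [cbar]
     applies to it. *)
  have mj : (col m < j)%N.
    have := col_nb mk; rewrite kj ltn_neqAle => ->/=.
    by rewrite jE -ltnS (prednK (ltnW chi2)) col_lt.
  by apply: le_trans (lS' _ _ mj) _; rewrite jE.
- move=> k k' /=; apply/andP; split.
    apply: sumr_ge0 => i _; case: ifP => // _.
    by rewrite addr_ge0// ?mulr_ge0// sumr_ge0// => m _; rewrite mulr_ge0.
  rewrite exprS -mulrA; apply: sum_le_size => // i _.
  case: ifPn => [/eqP kj|_ //].
  by apply: le_trans (inner _ _ kj) _; rewrite ler_wpM2l.
- move=> k k' k'j /=.
  rewrite exprS -mulrA; apply: sum_le_size => // i _.
  case: ifPn => [/eqP kj|kj]; first exact: inner.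
  by apply: lS'; move: k'j; rewrite ltnS leq_eqVlt (negPf kj).
Qed.

Lemma sweep_boundP j Gam : (j <= chi)%N -> sweep_bound 0 Gam ->
  sweep_bound j (sweep j Gam).
Proof.
move=> + Gam0; elim: j => //= j IH jchi.
by apply: sweep_boundS => //; apply: IH; exact: ltnW.
Qed.

Definition bounded_terms gam lam Gam : Prop :=
  (forall k, 0 <= Gam (k, None) <= gam) /\
  (forall k k', 0 <= Gam (k, Some k') <= lam).

(** After [chi] colours no site is left untreated, so the last clause of [sweep_bound] holds for
    every second site, and [th_l] turns it into [th * l]. *)
Lemma bounded_terms_sweep Gam : bounded_terms g l Gam ->
  bounded_terms (th * g) (th * l) (sweep chi Gam).
Proof.
move=> [gN lS].
have [] := @sweep_boundP chi Gam (leqnn _).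
  by split => // k k'; rewrite expr0 mul1r.
move=> gN' lS' lS''; split => [k|k k'].
  by have := gN' k; rewrite col_lt.
have /andP[-> _] /= := lS' k k'.
exact: le_trans (lS'' k k' (col_lt k')) th_l.
Qed.

End Sweeps.

(** * Oscillation bound after averaging at one site *)

Section SiteStep.
Context {R : realType} {L : countType} {d : measure_display}.
Context {Xi : measurableType d}.
Variables (e : rel L) (h : Xi -> R) (kappa c : L -> L -> R) (K : R).
Variables (nb : L -> seq L) (pi : L -> config L Xi -> probability Xi R).
Implicit Types (W : pred L) (t : L * option L) (x y : config L Xi).
Implicit Types (Th : seq (R * (L * option L))) (u : config L Xi -> R).

Definition ups x y (k : L) : R := upsilon R (x k) (y k).

Definition influence x y t : R :=
  if t.2 is Some k then ups x y t.1 * (h (x k) + h (y k)) else ups x y t.1.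

(** [transfer] applied to [influence] is a product in which the first site of the term governs this
    factor and the second site governs [right_factor]; averaging at one site is then treated factor
    by factor. *)
Definition left_factor W x y t : R :=
  match t with
  | (k, None) =>
    if W k then \sum_(i <- nb k) kappa k i * ups x y i +
      K^-1 * \sum_(i <- nb k) \sum_(j <- nb k) ups x y i * (h (x j) + h (y j))
    else ups x y k
  | (k, Some _) => \sum_(i <- if W k then nb k else [:: k]) ups x y i
  end.

(* The value 1/2 makes [right_factor x + right_factor y] equal to 1 on terms
   without a second site. *)
Definition right_factor W x t : R :=
  if t.2 is Some k then
    if W k then 1 + \sum_(j <- nb k) c k j * h (x j) else h (x k)
  else 2^-1.

Definition factored W x y t : R :=
  left_factor W x y t * (right_factor W x t + right_factor W y t).

Lemma transfer_influence W x y t :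
  transfer nb kappa c K W (influence x y) t = factored W x y t.
Proof.
case: t => k [k'|]; rewrite /factored /right_factor /=; last first.
  by rewrite (_ : 2^-1 + 2^-1 = 1 :> R) ?mulr1//; field.
rewrite mulr_suml; apply: eq_bigr => i _; case: (W k') => //.
rewrite /influence/= addrACA -mulr2n mulrDr [ups _ _ _ * 2]mulrC.
congr (_ + _); rewrite -big_split/= mulr_sumr; apply: eq_bigr => j _.
by rewrite -mulrDr mulrCA.
Qed.

Lemma ups_ge0 x y k : 0 <= ups x y k. Proof. exact: ler0n. Qed.

Lemma ups_le1 x y k : ups x y k <= 1.
Proof. by rewrite /ups /upsilon; case: eqP; rewrite ?ler01. Qed.

Lemma upsC x y k : ups x y k = ups y x k.
Proof. by rewrite /ups /upsilon eq_sym. Qed.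

Lemma upsxx x k : ups x x k = 0.
Proof. by rewrite /ups /upsilon eqxx. Qed.

Lemma ups_neq x y k : x k != y k -> ups x y k = 1.
Proof. by rewrite /ups /upsilon => ->. Qed.

Lemma left_factorC W x y t : left_factor W x y t = left_factor W y x t.
Proof.
case: t => k [k'|] /=; first by apply: eq_bigr => i _; rewrite upsC.
case: (W k); last exact: upsC.
congr (_ + _ * _); apply: eq_bigr => i _; first by rewrite upsC.
by apply: eq_bigr => j _; rewrite upsC addrC.
Qed.

Lemma left_factorxx W x t : left_factor W x x t = 0.
Proof.
case: t => k [k'|] /=; first by apply: big1 => i _; rewrite upsxx.
case: (W k); last exact: upsxx.
rewrite !big1 ?mulr0 ?addr0// => i _; rewrite ?upsxx ?mulr0//.
by apply: big1 => j _; rewrite mul0r.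
Qed.

Hypotheses (h_meas : measurable_fun setT h) (h_ge0 : forall xi, 0 <= h xi).
Hypotheses (kappa_ge0 : forall i j, 0 <= kappa i j).
Hypotheses (c_ge0 : forall i j, 0 <= c i j) (K0 : 0 < K).
Hypothesis nbE : forall k i, (i \in nb k) = e k i.
Hypothesis nb_uniq : forall k, uniq (nb k).
Hypothesis piP : spec_class e h K kappa c pi.

Lemma left_factor_ge0 W x y t : 0 <= left_factor W x y t.
Proof.
case: t => k [k'|] /=; first by apply: sumr_ge0 => i _; exact: ups_ge0.
case: (W k); last exact: ups_ge0.
rewrite addr_ge0//; first by apply: sumr_ge0 => i _; rewrite mulr_ge0// ups_ge0.
rewrite mulr_ge0 ?invr_ge0 ?(ltW K0)//; apply: sumr_ge0 => i _.
by apply: sumr_ge0 => j _; rewrite mulr_ge0 ?ups_ge0// addr_ge0.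
Qed.

Lemma right_factor_ge0 W x t : 0 <= right_factor W x t.
Proof.
rewrite /right_factor; case: t.2 => [k|]; last by rewrite invr_ge0.
case: (W k) => //; rewrite addr_ge0//.
by apply: sumr_ge0 => j _; rewrite mulr_ge0.
Qed.

Lemma sum_nbrs l (F : L -> R) :
  \sum_(i \in nbrs e l) F i = \sum_(i <- nb l) F i.
Proof.
rewrite (fsbig_seq _ _ (nb_uniq l)); congr (\big[_/_]_(i \in _) _).
by apply/seteqP; split => i /=; rewrite nbE.
Qed.

Lemma ler_sum_mem (s : seq L) (F : L -> R) i : i \in s ->
  (forall j, 0 <= F j) -> F i <= \sum_(j <- s) F j.
Proof.
by move=> si F0; rewrite (big_rem i)//= lerDl; apply: sumr_ge0.
Qed.

Variable l : L.

Let m x : R := \int[pi l x]_xi h xi.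

Lemma site_moment_lty x : (\int[pi l x]_xi (h xi)%:E < +oo)%E.
Proof.
exact: le_lt_trans (spec_class_growth piP l x) (ltry _).
Qed.

Let m_ge0 x : 0 <= m x.
Proof. by apply: Rintegral_ge0 => xi _. Qed.

Lemma site_moment_le x : m x <= 1 + \sum_(j <- nb l) c l j * h (x j).
Proof.
rewrite -lee_fin -sum_nbrs; apply: le_trans (spec_class_growth piP l x).
rewrite /m /Rintegral fineK// ge0_fin_numE; first exact: site_moment_lty.
by apply: integral_ge0 => xi _; rewrite lee_fin.
Qed.

Let agree_dec x y : (forall i, i \in nb l -> x i = y i) \/
  (exists2 i, i \in nb l & x i != y i).
Proof.
have [/allP a|/allPn[i il ne]] := boolP (all (fun i => x i == y i) (nb l)).
  by left => i /a/eqP.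
by right; exists i.
Qed.

(** A bound for the total variation distance between the two laws at [l], once [l] is in [W]. The
    first entry serves the term [(l, None)]; the second, which counts the disagreeing neighbours,
    serves the terms [(l, Some k)]. *)
Let Dl W x y : R := Num.min (left_factor W x y (l, None))
                            (left_factor W x y (l, Some l)).

Let site_local x y : (forall i, i \in nb l -> x i = y i) ->
  forall A, measurable A -> pi l x A = pi l y A.
Proof.
move=> xy A mA; apply: (spec_local (spec_class_spec piP)) => // i.
by rewrite -nbE; exact: xy.
Qed.

(** If the neighbours agree, the laws coincide. Otherwise the second entry of [Dl] is at least 1.
    The first is covered by the contraction hypothesis when all neighbouring spins satisfy [h <= K],
    and is at least 1 when one of them does not. *)
Lemma site_total_variation W x y A : W l -> measurable A ->
  (pi l x A <= pi l y A + (Dl W x y)%:E)%E.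
Proof.
move=> Wl mA.
have D0 : 0 <= Dl W x y by rewrite le_min !left_factor_ge0.
have [agree|[i il ne]] := agree_dec x y.
  by rewrite (site_local agree mA) leeDl// lee_fin.
have pE z : pi l z A = (fine (pi l z A))%:E.
  by rewrite fineK//; exact: fin_num_measure.
have p01 z : 0 <= fine (pi l z A) <= 1.
  by rewrite -!lee_fin -pE measure_ge0 probability_le1.
rewrite (pE x) (pE y) -EFinD lee_fin -lerBlDl le_min /=.
have /andP[x0 x1] := p01 x; have /andP[y0 y1] := p01 y.
have big1 (S : R) : 1 <= S -> fine (pi l x A) - fine (pi l y A) <= S by lra.
have k0 : 0 <= \sum_(j <- nb l) kappa l j * ups x y j.
  by apply: sumr_ge0 => j _; rewrite mulr_ge0// ups_ge0.
have hh0 z z' j : 0 <= h (z j) + h (z' j) by rewrite addr_ge0.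
have s0 : 0 <=
    \sum_(i <- nb l) \sum_(j <- nb l) ups x y i * (h (x j) + h (y j)).
  by apply: sumr_ge0 => k _; apply: sumr_ge0 => j _; rewrite mulr_ge0// ups_ge0.
rewrite Wl; apply/andP; split; last first.
  apply: big1; rewrite -(ups_neq ne); apply: (ler_sum_mem il) => j;
    exact: ups_ge0.
have [small|/allPn[j jl]] := boolP (all (fun j =>
  (h (x j) <= K) && (h (y j) <= K)) (nb l)).
  apply: (@le_trans _ _ (\sum_(j <- nb l) kappa l j * ups x y j)); last first.
    by rewrite lerDl mulr_ge0// invr_ge0 ltW.
  have bnd z : (forall j, j \in nb l -> h (z j) <= K) -> bounded_nbhd e h K l z.
    by move=> zK j; rewrite -nbE; exact: zK.
  have bx : bounded_nbhd e h K l x by apply: bnd => j /(allP small)/andP[].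
  have by_ : bounded_nbhd e h K l y by apply: bnd => j /(allP small)/andP[].
  have := spec_class_contraction piP bx by_; rewrite sum_nbrs => tv.
  apply: le_trans (ler_norm _) _; rewrite -lee_fin; apply: le_trans tv.
  apply: ereal_sup_ubound; exists A => //.
  by rewrite (pE x) (pE y) -EFinB.
(* Some neighbour [i] disagrees and some neighbour [j] has [h > K]: the single summand at [i], [j]
   already exceeds [K]. *)
rewrite negb_and -!ltNge => big; apply: big1.
rewrite -[1]addr0 addrC lerD//.
rewrite mulrC ler_pdivlMr// mul1r.
apply: (@le_trans _ _ (\sum_(j <- nb l) ups x y i * (h (x j) + h (y j))));
  last first.
  apply: (ler_sum_mem (F := fun i =>
    \sum_(j <- nb l) ups x y i * (h (x j) + h (y j))) il) => k.
  by apply: sumr_ge0 => n _; rewrite mulr_ge0// ups_ge0.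
rewrite ups_neq//.
apply: le_trans (ler_sum_mem jl _); last by move=> n; rewrite mul1r.
rewrite mul1r; have := h_ge0 (x j); have := h_ge0 (y j).
by case/orP: big => /ltW; lra.
Qed.

Section Step.
Variable W : pred L.
Hypotheses (Wl : ~~ W l) (Wnb : forall k, W k -> l \notin nb k).

Let W' : pred L := [pred k | (k == l) || W k].

Let ups_update x y xi eta k :
  ups (update l x xi) (update l y eta) k =
  if k == l then upsilon R xi eta else ups x y k.
Proof. by rewrite /ups !updateE; case: eqP. Qed.

Let sum_update (F G : L -> R) k : W k ->
  (forall i, i != l -> F i = G i) ->
  \sum_(i <- nb k) F i = \sum_(i <- nb k) G i.
Proof.
move=> Wk FG; rewrite big_seq [RHS]big_seq; apply: eq_bigr => i ik.
by apply: FG; apply: contraNneq (Wnb Wk) => <-.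
Qed.

(** No site of [W] is adjacent to [l], so sums over the neighbours of such a site do not see the
    spin at [l], which enters only through terms that name [l]. *)
Lemma left_factor_update x y xi eta t : t.1 != l ->
  left_factor W (update l x xi) (update l y eta) t = left_factor W x y t.
Proof.
case: t => k [k'|] /= kl; case: (boolP (W k)) => Wk.
- by apply: (sum_update Wk) => i il; rewrite ups_update (negPf il).
- by rewrite !big_seq1 ups_update (negPf kl).
- congr (_ + _ * _).
    by apply: (sum_update Wk) => i il; rewrite ups_update (negPf il).
  apply: (sum_update Wk) => i il; apply: (sum_update Wk) => j jl.
  by rewrite ups_update (negPf il) !updateE (negPf jl).
- by rewrite ups_update (negPf kl).
Qed.

Lemma left_factor_update_site x y xi eta t : t.1 = l ->
  left_factor W (update l x xi) (update l y eta) t = upsilon R xi eta.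
Proof.
case: t => k [k'|] /= kl; rewrite kl (negPf Wl) ?big_seq1 ups_update eqxx//.
Qed.

Lemma right_factor_update x xi t : t.2 != Some l ->
  right_factor W (update l x xi) t = right_factor W x t.
Proof.
rewrite /right_factor; case: t.2 => [k|//] kl; case: (boolP (W k)) => Wk.
  congr (1 + _); apply: (sum_update Wk) => i il.
  by rewrite updateE (negPf il).
by rewrite updateE ifN//; apply: contraNneq kl => ->.
Qed.

Lemma right_factor_update_site x xi t : t.2 = Some l ->
  right_factor W (update l x xi) t = h xi.
Proof. by rewrite /right_factor => ->; rewrite (negPf Wl) updateE eqxx. Qed.

Let left_factorS x y t : t.1 != l -> left_factor W' x y t = left_factor W x y t.
Proof.
by case: t => k k' /= kl; rewrite /left_factor /W' /= (negPf kl).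
Qed.

Let right_factorS x t :
  t.2 != Some l -> right_factor W' x t = right_factor W x t.
Proof.
rewrite /right_factor; case: t.2 => [k|//] kl.
by rewrite /W' /= (_ : (k == l) = false)//; apply: contraNF kl => /eqP ->.
Qed.

Let right_factorS_site x t : t.2 = Some l ->
  right_factor W' x t = 1 + \sum_(j <- nb l) c l j * h (x j).
Proof. by rewrite /right_factor => ->; rewrite /W' /= eqxx. Qed.

Variables (Th : seq (R * (L * option L))) (u : config L Xi -> R) (B : R).
Hypothesis Th0 : forall p, p \in Th -> 0 <= p.1.
Hypotheses (u_meas : measurable_fun setT u) (u_bnd : forall x, 0 <= u x <= B).
Hypothesis u_dom : forall x y, `|u x - u y| <= pairing Th (factored W x y).

Let E01 x y := left_factor W' x y (l, Some l).

(* Bounds obtained by moving from [x] to [y] first outside [l], then in the law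
   of the spin at [l]; they become symmetric only after adding the bounds
   obtained with [x] and [y] exchanged. *)
Let half_step x y t : R :=
  if t.1 == l then
    if t.2 == Some l then E01 x y * (m x + m y)
    else Dl W' x y * (2 * right_factor W y t)
  else
    if t.2 == Some l then left_factor W x y t * (2 * m x)
    else factored W x y t.

Let site_average_half_step x y :
  `|site_average pi l u x - site_average pi l u y| <=
    pairing Th (half_step x y).
Proof.
(* With equal spins at [l], the bound is [ca + cb * h xi]; with only the spin at [l] changing, it is
   [cA + cB * (h xi + h eta)]. The cases are whether [l] is the first site of the term, and whether
   it is the second. *)
pose ca t := if (t.1 == l) || (t.2 == Some l) then 0 else factored W x y t.
pose cb t :=
  if (t.1 != l) && (t.2 == Some l) then left_factor W x y t * 2 else 0.
pose cA t :=
  if (t.1 == l) && (t.2 != Some l) then 2 * right_factor W y t else 0.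
pose cB t : R := if (t.1 == l) && (t.2 == Some l) then 1 else 0.
have pD (F G : L * option L -> R) :
    pairing Th F + pairing Th G = pairing Th (fun t => F t + G t).
  by rewrite /pairing -big_split; apply: eq_bigr => p _; rewrite /= mulrDr.
have pM (F : L * option L -> R) (z : R) :
    pairing Th F * z = pairing Th (fun t => F t * z).
  by rewrite /pairing mulr_suml; apply: eq_bigr => p _; rewrite /= mulrA.
have Wl' : W' l by rewrite /W' /= eqxx.
have D0 z z' : 0 <= Dl W' z z' by rewrite le_min !left_factor_ge0.
have Dsym : Dl W' x y = Dl W' y x by rewrite /Dl !(left_factorC _ x).
have u_norm z : `|u z| <= B by have /andP[? ?] := u_bnd z; rewrite ger0_norm.
have pos F : (forall t, 0 <= F t) -> 0 <= pairing Th F.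
  by move=> F0; rewrite /pairing big_seq; apply: sumr_ge0 => p pTh;
    rewrite mulr_ge0 ?Th0.
have v12 xi : `|u (update l x xi) - u (update l y xi)| <=
    pairing Th ca + pairing Th cb * h xi.
  apply: le_trans (u_dom _ _) _; rewrite pM pD;
    apply: le_pairing => // -[w t] _ /=.
  rewrite /ca /cb /factored; case: (eqVneq t.1 l) => [tl|tl] /=.
    by rewrite left_factor_update_site// /upsilon eqxx !mul0r addr0.
  rewrite left_factor_update//; case: (eqVneq t.2 (Some l)) => [tr|tr].
    by rewrite !right_factor_update_site// add0r -mulrA -mulr2n mulr_natl.
  by rewrite !right_factor_update// mul0r addr0.
have osc xi eta : `|u (update l y xi) - u (update l y eta)| <=
    pairing Th cA + pairing Th cB * (h xi + h eta).
  apply: le_trans (u_dom _ _) _; rewrite pM pD;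
    apply: le_pairing => // -[w t] _ /=.
  rewrite /cA /cB /factored; case: (eqVneq t.1 l) => [tl|tl] /=; last first.
    by rewrite left_factor_update// left_factorxx !mul0r addr0.
  rewrite left_factor_update_site//.
  have ups1 : upsilon R xi eta <= 1 by rewrite /upsilon; case: eqP;
    rewrite ?ler01.
  case: (eqVneq t.2 (Some l)) => [tr|tr] /=.
    by rewrite !right_factor_update_site// add0r ler_wpM2r// addr_ge0.
  rewrite !right_factor_update// mul0r addr0 -mulr2n mulr_natl.
  by rewrite ler_piMl// mulrn_wge0// right_factor_ge0.
have meas z : measurable_fun setT (fun xi => u (update l z xi)).
  exact: measurableT_comp u_meas (measurable_update_site l z).
have ca0 t : 0 <= ca t.
  by rewrite /ca; case: ifP => // _; rewrite mulr_ge0 ?left_factor_ge0//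
    addr_ge0 ?right_factor_ge0.
have cb0 t : 0 <= cb t by rewrite /cb; case: ifP => // _;
  rewrite mulr_ge0 ?left_factor_ge0.
have cA0 t : 0 <= cA t by rewrite /cA; case: ifP => // _;
  rewrite mulr_ge0 ?right_factor_ge0.
have cB0 t : 0 <= cB t by rewrite /cB; case: ifP.
have E0 : 0 <= E01 x y by exact: left_factor_ge0.
(* Agreement around [l] makes the two laws at [l] equal, so that only the integrand changes.
   Otherwise [E01 x y >= 1], and this factor may be inserted in the terms [(l, Some l)]. *)
have [agree|[i il ne]] := agree_dec x y.
  have -> : site_average pi l u y = \int[pi l x]_xi u (update l y xi).
    congr fine; apply: eq_measure_integral => A mA _.
    exact: (esym (site_local agree mA)).
  rewrite /site_average -RintegralB//; last 2 first.
  - by apply: (@integrable_dominated _ _ _ _ _ (cst B)) => //;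
      exact: finite_measure_integrable_cst.
  - by apply: (@integrable_dominated _ _ _ _ _ (cst B)) => //;
      exact: finite_measure_integrable_cst.
  apply: le_trans (Rintegral_norm_le (measurable_funB (meas x) (meas y)) h_meas
    h_ge0 (site_moment_lty x) v12) _.
  rewrite pM pD; apply: le_pairing => // -[w t] _ /=;
    rewrite /ca /cb /half_step -/(m x).
  case: (eqVneq t.1 l) => tl; case: (eqVneq t.2 (Some l)) => tr /=;
    rewrite ?mul0r ?addr0 ?add0r ?mulrA//.
    by rewrite mulr_ge0// addr_ge0.
  by rewrite !mulr_ge0// right_factor_ge0.
have E1 : 1 <= E01 x y.
  rewrite /E01 /= /W' /= eqxx/= -(ups_neq ne).
  by apply: (ler_sum_mem il) => j; exact: ups_ge0.
have tv1 A : measurable A -> (pi l x A <= pi l y A + (Dl W' x y)%:E)%E.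
  exact: site_total_variation.
have tv2 A : measurable A -> (pi l y A <= pi l x A + (Dl W' x y)%:E)%E.
  by rewrite Dsym; exact: site_total_variation.
have := dist_Rintegral_le h_meas h_ge0 (site_moment_lty x) (site_moment_lty y)
  (meas x) (fun xi => u_norm _) (meas y) (fun xi => u_norm _)
  (pos _ cA0) (pos _ cB0) (D0 x y) v12 osc tv1 tv2.
rewrite -/(m x) -/(m y) => /le_trans; apply.
rewrite !pM !pD; apply: le_pairing => // -[w t] _ /=;
  rewrite /ca /cb /cA /cB /half_step.
case: (eqVneq t.1 l) => tl; case: (eqVneq t.2 (Some l)) => tr /=;
  rewrite ?mul0r ?addr0 ?add0r ?mul1r ?mulrA//.
  by rewrite ler_peMl// addr_ge0.
by rewrite mulrC mulrA.
Qed.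

(** The half steps from [x] to [y] and from [y] to [x] add up to a symmetric bound; the growth
    hypothesis then replaces the moments at [l] by right factors, and [Dl] is at most the left
    factor of any term starting at [l]. *)
Lemma site_average_dominated x y :
  `|site_average pi l u x - site_average pi l u y| <=
    pairing Th (factored W' x y).
Proof.
have := site_average_half_step x y; have := site_average_half_step y x.
rewrite distrC => H1 H2.
suff : pairing Th (half_step x y) + pairing Th (half_step y x) <=
    2 * pairing Th (factored W' x y) by move: H1 H2; lra.
rewrite /pairing -big_split mulr_sumr /= big_seq [leRHS]big_seq.
apply: ler_sum => -[w t] /Th0/= w0.
rewrite -mulrDr [leRHS]mulrCA ler_wpM2l// /half_step /factored /E01.
have mx := site_moment_le x; have my := site_moment_le y.
have R0 z := right_factor_ge0 W z t.
have Lf0 := left_factor_ge0 W x y t.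
have E0 := left_factor_ge0 W' x y (l, Some l).
case: (eqVneq t.1 l) => tl; case: (eqVneq t.2 (Some l)) => tr.
- rewrite !right_factorS_site// (left_factorC _ y).
  have -> : left_factor W' x y t = left_factor W' x y (l, Some l).
    by move: tl tr; case: (t) => k k' /= -> ->.
  by rewrite [m y + m x]addrC -mulr2n -[leLHS]mulr_natl ler_wpM2l// ler_wpM2l//
    lerD.
- rewrite !right_factorS// /Dl !(left_factorC _ y x) -/(Dl W' x y).
  have DL : Dl W' x y <= left_factor W' x y t.
    rewrite /Dl; move: tl; case: (t) => k [k'|] /= ->;
      rewrite ge_min lexx ?orbT//.
  have := R0 x; have := R0 y; set rx := right_factor W x t;
    set ry := right_factor W y t.
  move=> y0 x0; rewrite -mulrDr -mulrDr [ry + rx]addrC mulrCA ler_wpM2l//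
    ler_wpM2r// addr_ge0//.
- rewrite !right_factorS_site// left_factorS// (left_factorC _ y) -mulrDr
    -mulrDr mulrCA.
  by rewrite ler_wpM2l// ler_wpM2l// lerD.
- rewrite !right_factorS// left_factorS// (left_factorC _ y).
  by rewrite [right_factor W y t + _]addrC -mulr2n -[leLHS]mulr_natl.
Qed.

End Step.
End SiteStep.

(** * Averages that keep integrals against functions of one spin *)

Section SameIntegrals.
Context {R : realType} {L : countType} {d : measure_display}.
Context {Xi : measurableType d}.
Implicit Types (f u v : config L Xi -> R) (x y : config L Xi).
Implicit Types (pi : L -> config L Xi -> probability Xi R).
Implicit Types (mu : probability (config L Xi) R).

(** Equality of the conditional expectations given [x l1], expressed through bounded nonnegative
    test functions. *)
Definition same_integrals mu (l1 : L) u v : Prop :=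
  forall f C, measurable_fun setT f -> (forall x, 0 <= f x <= C) ->
    (forall x y, x l1 = y l1 -> f x = f y) ->
    \int[mu]_x (f x * u x) = \int[mu]_x (f x * v x).

Lemma site_average_bounded pi l u (B : R) : measurable_fun setT u ->
  (forall x, 0 <= u x <= B) ->
  forall x, 0 <= site_average pi l u x <= B.
Proof.
move=> mu_ uB x; rewrite /site_average.
have mux : measurable_fun setT (fun xi => u (update l x xi)).
  exact: measurableT_comp mu_ (measurable_update_site l x).
rewrite Rintegral_ge0/=; last by move=> xi _; have /andP[] := uB (update l x
  xi).
have -> : B = \int[pi l x]_xi (cst B xi).
  by rewrite Rintegral_cst// [X in fine X](@probability_setT _ _ _ (pi l x))
    mulr1.
apply: le_Rintegral => //.
- apply: (@integrable_dominated _ _ _ _ _ (cst B)) => //.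
    exact: finite_measure_integrable_cst.
  by move=> xi; have /andP[? ?] := uB (update l x xi); rewrite ger0_norm.
- exact: finite_measure_integrable_cst.
- by move=> xi _; have /andP[] := uB (update l x xi).
Qed.

Lemma site_averageE pi l u (B : R) x : measurable_fun setT u ->
  (forall x, 0 <= u x <= B) ->
  (site_average pi l u x)%:E = (\int[pi l x]_xi (u (update l x xi))%:E)%E.
Proof.
move=> mu_ uB; rewrite /site_average /Rintegral fineK//.
apply: (integrable_fin_num measurableT).
apply: (@integrable_dominated _ _ _ _ _ (cst B)) => //.
- exact: measurableT_comp mu_ (measurable_update_site l x).
- exact: finite_measure_integrable_cst.
- by move=> xi; have /andP[? ?] := uB (update l x xi); rewrite ger0_norm.
Qed.

(** The test function does not see the spin at [l], so it comes out of the inner integral that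
    consistency introduces. *)
Lemma site_average_integral pi mu (l l1 : L) u (B : R) :
  (forall A : set Xi, measurable A ->
    measurable_fun setT (fun x : config_off Xi l => pi l x A)) ->
  consistent pi mu -> l != l1 ->
  measurable_fun setT u -> (forall x, 0 <= u x <= B) ->
  same_integrals mu l1 (site_average pi l u) u.
Proof.
move=> mpi muP ll1 mu_ uB f C mf fC fl1; congr fine; apply/esym.
have f0 x : 0 <= f x by have /andP[] := fC x.
have u0 x : 0 <= u x by have /andP[] := uB x.
rewrite (consistent_integral mpi muP); last 2 first.
- by apply/measurable_EFinP; exact: measurable_funM.
- by move=> x; rewrite lee_fin mulr_ge0.
apply: eq_integral => x _.
under eq_integral => xi _.
  rewrite (fl1 (update l x xi) x); last by rewrite updateE eq_sym (negPf ll1).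
  rewrite EFinM; over.
rewrite ge0_integralZl_EFin//.
- by rewrite EFinM (site_averageE pi l x mu_ uB).
- by move=> xi _; rewrite lee_fin.
- apply/measurable_EFinP.
  exact: measurableT_comp mu_ (measurable_update_site l x).
Qed.

Lemma same_integrals_trans mu l1 u v w :
  same_integrals mu l1 u v -> same_integrals mu l1 v w ->
  same_integrals mu l1 u w.
Proof. by move=> uv vw f C mf fC fl; rewrite (uv f C)// (vw f C). Qed.

End SameIntegrals.

(** * Averaging colour class by colour class, away from [l1] *)

Section Stages.
Context {R : realType} {L : countType} {d : measure_display}.
Context {Xi : measurableType d}.
Variables (e : rel L) (h : Xi -> R) (kappa c : L -> L -> R) (K : R).
Variables (nb : L -> seq L) (pi : L -> config L Xi -> probability Xi R).
Variables (mu : probability (config L Xi) R) (col : L -> nat) (l1 l2 : L).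
Implicit Types (Th : seq (R * (L * option L))) (u v : config L Xi -> R).
Implicit Types (x y : config L Xi).
Hypotheses (h_meas : measurable_fun setT h) (h_ge0 : forall xi, 0 <= h xi).
Hypotheses (kappa_ge0 : forall i j, 0 <= kappa i j).
Hypotheses (c_ge0 : forall i j, 0 <= c i j) (K0 : 0 < K).
Hypothesis nbE : forall k i, (i \in nb k) = e k i.
Hypothesis nb_uniq : forall k, uniq (nb k).
Hypothesis e_sym : symmetric e.
Hypothesis col_proper : forall k i, e k i -> col k != col i.
Hypotheses (piP : spec_class e h K kappa c pi) (muP : consistent pi mu).

Let mpi l (A : set Xi) : measurable A ->
  measurable_fun setT (fun x : config_off Xi l => pi l x A).
Proof. exact: spec_measurable (spec_class_spec piP) l A. Qed.

Definition near_site r (k : L) : Prop :=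
  exists2 n, (n <= r)%N & walk_of_length e k l2 n.

Lemma near_siteS r k i : near_site r k -> e i k -> near_site r.+1 i.
Proof.
move=> [n nr [p [pp lp sp]]] ik; exists n.+1 => //.
by exists (k :: p); split => //=; [rewrite ik|rewrite sp].
Qed.

Lemma near_siteW r r' k : (r <= r')%N -> near_site r k -> near_site r' k.
Proof. by move=> rr' [n nr kn]; exists n => //; exact: leq_trans rr'. Qed.

(** The invariant of the averaging: [u] can replace [v] in covariances with functions of [x l1], and
    its oscillation is controlled by terms supported within distance [r] of [l2]. *)
Record controlled (B : R) v r u Th : Prop := Controlled {
  controlled_meas : measurable_fun setT u;
  controlled_bnd : forall x, 0 <= u x <= B;
  controlled_same : same_integrals mu l1 u v;
  controlled_ge0 : forall p, p \in Th -> 0 <= p.1;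
  controlled_near : forall k, k \in sites Th -> near_site r k;
  controlled_dom : forall x y, `|u x - u y| <= pairing Th (influence h x y) }.

(** The sites of one colour are averaged one after another; as the colouring is proper, a new site
    is never adjacent to those already treated. *)
Lemma colour_class_average (B : R) v r u Th j (I : seq L) :
  controlled B v r u Th -> uniq I -> l1 \notin I ->
  (forall k, k \in I -> col k = j) ->
  exists u', [/\ measurable_fun setT u', forall x, 0 <= u' x <= B,
    same_integrals mu l1 u' v &
    forall x y, `|u' x - u' y| <=
      pairing Th (factored h kappa c K nb (fun k => k \in I) x y)].
Proof.
move=> [um ub us Th0 _ ud]; elim: I => [_ _ _|l I IH /= /andP[lI uI]].
  exists u; split => // x y; apply: le_trans (ud x y) _.
  by apply: le_pairing => // -[w [k [k'|]]] _;
    rewrite -transfer_influence /= ?big_seq1.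
rewrite inE negb_or => /andP[l1l l1I] colI.
have [|u' [um' ub' us' ud']] := IH uI l1I.
  by move=> k kI; apply: colI; rewrite inE kI orbT.
exists (site_average pi l u'); split.
- apply: measurable_site_average => //; first exact: mpi.
  by move=> x; have /andP[] := ub' x.
- exact: site_average_bounded.
- apply: same_integrals_trans us'; apply: site_average_integral ub' => //.
  + exact: mpi.
  + by rewrite eq_sym.
- move=> x y.
  rewrite (_ : in_mem^~ (mem (l :: I)) = fun k => (k == l) || (k \in I));
    last first.
    by apply/funext => k; rewrite inE.
  apply: (site_average_dominated h_meas h_ge0 kappa_ge0 c_ge0 K0 nbE nb_uniq
    piP _ _ Th0 um' ub' ud') => //.
  move=> k kI; rewrite nbE; apply/negP => /col_proper.
  by rewrite !colI ?eqxx// inE ?eqxx// kI orbT.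
Qed.

Lemma controlled_stage (B : R) v r u Th j : controlled B v r u Th ->
  ~ near_site r l1 ->
  exists u', controlled B v r.+1 u'
    (adjoint nb kappa c K [pred k | col k == j] Th).
Proof.
move=> ctl l1far.
(* Only the finitely many sites of colour [j] that occur in [Th] are averaged; on the terms of [Th],
   [I] and the full colour class give the same factors. *)
pose I := undup [seq k <- sites Th | col k == j].
have [|||u' [um' ub' us' ud']] := @colour_class_average B v r u Th j I ctl.
- exact: undup_uniq.
- apply/negP; rewrite mem_undup mem_filter => /andP[_ /(controlled_near ctl)].
  exact: l1far.
- by move=> k; rewrite mem_undup mem_filter => /andP[/eqP].
exists u'; split => //.
- exact: adjoint_ge0 (controlled_ge0 ctl).
- move=> i /sites_adjoint[/(controlled_near ctl)|[k /(controlled_near ctl) kr]].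
    exact: near_siteW.
  by rewrite nbE => ki; apply: near_siteS kr _; rewrite e_sym.
move=> x y; apply: le_trans (ud' x y) _; rewrite pairing_adjoint.
apply: le_pairing => [|p pTh]; first exact: (controlled_ge0 ctl).
rewrite transfer_influence.
have WE k : k \in term_sites p.2 -> (k \in I) = (col k == j).
  move=> kp; rewrite mem_undup mem_filter andb_idr// => _.
  by apply/flattenP; exists (term_sites p.2) => //; exact: map_f.
have := WE p.2.1; rewrite inE eqxx => /(_ isT) W1.
move: p.2 WE W1 => [k [k'|]] /= WE W1; rewrite /factored /right_factor /= W1//.
by rewrite (WE k')// !inE eqxx orbT.
Qed.

Lemma controlled_sweep (B : R) v r u Th j : controlled B v r u Th ->
  ~ near_site (r + j) l1 ->
  exists u', controlled B v (r + j) u' (sweep_adjoint nb kappa c K col j Th).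
Proof.
elim: j r u Th => [|j IH] r u Th ctl; first by rewrite addn0; exists u.
rewrite addnS => far.
have [|u' ctl'] := controlled_stage j ctl.
  by move=> /(@near_siteW _ (r + j).+1) nr; apply: far; apply: nr;
    rewrite leqW// leq_addr.
by rewrite -addSn; apply: (IH _ u'); rewrite ?addSn.
Qed.

Lemma controlled_iter_sweep (B : R) v u Th j n : controlled B v 0 u Th ->
  ~ near_site (n * j) l1 ->
  exists u', controlled B v (n * j) u'
    (iter n (sweep_adjoint nb kappa c K col j) Th).
Proof.
move=> ctl; elim: n => [_|n IH]; first by rewrite mul0n; exists u.
rewrite mulSn addnC => far; have [|u' ctl'] := IH.
  by move=> /(@near_siteW _ (n * j + j)) nr; apply: far; apply: nr;
    rewrite leq_addr.
by rewrite iterS; apply: controlled_sweep ctl' far.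
Qed.

End Stages.

(** * Uniform moment bound and covariance estimate *)

Section Covariance.
Context {R : realType} {L : countType} {d : measure_display}.
Context {Xi : measurableType d}.
Variables (e : rel L) (h : Xi -> R) (kappa c : L -> L -> R) (K : R).
Variables (nb : L -> seq L) (pi : L -> config L Xi -> probability Xi R).
Variables (mu : probability (config L Xi) R) (l1 l2 : L) (cbar : R).
Implicit Types (f g u v : config L Xi -> R) (x y : config L Xi).
Implicit Types (Th : seq (R * (L * option L))).
Hypotheses (h_meas : measurable_fun setT h) (h_ge0 : forall xi, 0 <= h xi).
Hypothesis c_ge0 : forall i j, 0 <= c i j.
Hypothesis nbE : forall k i, (i \in nb k) = e k i.
Hypothesis nb_uniq : forall k, uniq (nb k).
Hypothesis c_le : forall k, \sum_(i <- nb k) c k i <= cbar.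
Hypothesis cbar_lt1 : cbar < 1.
Hypothesis piP : spec_class e h K kappa c pi.
Hypothesis muP : tempered_states pi h mu.

Let h_site_meas (k : L) : measurable_fun setT (fun x : config L Xi => h (x k)).
Proof. exact: measurableT_comp h_meas (measurable_coord k). Qed.

(** Consistency and the growth hypothesis give [S <= 1 + cbar * S] for the supremum [S] of the
    moments; temperedness makes [S] finite, so the inequality can be solved. *)
Lemma tempered_moment_le k :
  (\int[mu]_x (h (x k))%:E <= (1 / (1 - cbar))%:E)%E.
Proof.
have [mu_cons] := muP; set S := ereal_sup _ => S_lty.
have mS i : (\int[mu]_x (h (x i))%:E <= S)%E.
  by apply: ereal_sup_ubound; exists i.
have S0 : (0 <= S)%E.
  by apply: le_trans (mS k); apply: integral_ge0 => x _; rewrite lee_fin.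
have SE : S = (fine S)%:E by rewrite fineK// ge0_fin_numE.
apply: le_trans (mS k) _; rewrite SE lee_fin ler_pdivlMr ?subr_gt0//.
suff : fine S <= 1 + cbar * fine S by move: (fine S) => s; lra.
have s0 : 0 <= fine S by rewrite -lee_fin -SE.
rewrite -lee_fin -SE; apply: ge_ereal_sup => _ [i _ <-].
have mh : measurable_fun setT (fun x : config L Xi => (h (x i))%:E).
  exact/measurable_EFinP.
have mpi A : measurable A ->
    measurable_fun setT (fun x : config_off Xi i => pi i x A).
  exact: spec_measurable (spec_class_spec piP) i A.
rewrite (consistent_integral mpi mu_cons mh); last by move=> x; rewrite lee_fin.
apply: (@le_trans _ _
  (\int[mu]_x (1 + \sum_(j <- nb i) (c i j)%:E * (h (x j))%:E))%E).
  apply: ge0_le_integral => //.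
  - by move=> x _; apply: integral_ge0 => xi _; rewrite lee_fin.
  - by apply: (measurable_site_integral mpi mh) => x; rewrite lee_fin.
  - apply: emeasurable_funD => //; apply: emeasurable_sum => j.
    by apply: emeasurable_funM => //; exact/measurable_EFinP.
  - move=> x _; under eq_integral do rewrite updateE eqxx.
    apply: le_trans (spec_class_growth piP i x) _.
    by rewrite (sum_nbrs nbE nb_uniq) EFinD -sumEFin.
rewrite ge0_integralD//; last 2 first.
- by move=> x _; apply: sume_ge0 => j _; rewrite mule_ge0// lee_fin.
- apply: emeasurable_sum => j.
  by apply: emeasurable_funM => //; exact/measurable_EFinP.
rewrite integral_cst// mul1e [X in (X + _)%E](@probability_setT _ _ _ mu) EFinD
  leeD2l//.
rewrite ge0_integral_sum//; last 2 first.
- by move=> j; apply: emeasurable_funM => //; exact/measurable_EFinP.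
- by move=> j x _; rewrite mule_ge0// lee_fin.
apply: (@le_trans _ _ (\sum_(j <- nb i) (c i j * fine S)%:E)%E).
  apply: lee_sum => j _; rewrite ge0_integralZl_EFin//.
  - by rewrite EFinM lee_wpmul2l ?lee_fin// -SE.
  - by move=> x _; rewrite lee_fin.
  - exact/measurable_EFinP.
by rewrite sumEFin lee_fin -mulr_suml ler_wpM2r.
Qed.

Lemma tempered_moment_lty k : (\int[mu]_x (h (x k))%:E < +oo)%E.
Proof. exact: le_lt_trans (tempered_moment_le k) (ltry _). Qed.

Definition moment k : R := \int[mu]_x h (x k).

Lemma moment_ge0 k : 0 <= moment k.
Proof. by apply: Rintegral_ge0 => x _. Qed.

Lemma moment_le k : moment k <= 1 / (1 - cbar).
Proof.
rewrite -lee_fin; apply: le_trans (tempered_moment_le k).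
rewrite /moment /Rintegral fineK// ge0_fin_numE;
  first exact: tempered_moment_lty.
by apply: integral_ge0 => x _; rewrite lee_fin.
Qed.

Lemma pairing_integral Th (F : L * option L -> config L Xi -> R) :
  (forall t, mu.-integrable setT (EFin \o F t)) ->
  mu.-integrable setT (EFin \o (fun x => pairing Th (F^~ x))) /\
  \int[mu]_x pairing Th (F^~ x) = pairing Th (fun t => \int[mu]_x F t x).
Proof.
move=> iF; elim: Th => [|p Th [IH1 IH2]].
  rewrite (_ : (fun x => _) = cst 0); last by apply/funext => x;
    rewrite /pairing big_nil.
  by split; [exact: integrable0|rewrite Rintegral_cst// mul0r /pairing big_nil].
have pE x : pairing (p :: Th) (F^~ x) = p.1 * F p.2 x + pairing Th (F^~ x).
  by rewrite /pairing big_cons.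
have ip : mu.-integrable setT (EFin \o (fun x => p.1 * F p.2 x)).
  exact: (integrableZl measurableT p.1 (iF p.2)).
rewrite (_ : (fun x => _) = fun x => p.1 * F p.2 x + pairing Th (F^~ x));
  last exact/funext.
split; first exact: (integrableD measurableT ip IH1).
by rewrite (RintegralD measurableT ip IH1) RintegralZl// IH2 /pairing big_cons.
Qed.

(** The covariance with [v] equals that with [u], whose oscillation is at most [b x + b y].
    Integrating over [y] bounds the deviation of [u] from its mean by [b x + bb]; integrating over
    [x] gives [A * (bb + bb)]. *)
Lemma covariance_le (A B : R) f v r u Th :
  measurable_fun setT f -> (forall x, 0 <= f x <= A) ->
  (forall x y, x l1 = y l1 -> f x = f y) ->
  controlled e h mu l1 l2 B v r u Th ->
  `|Cov mu f v| <= A *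
    pairing Th (fun t => if t.2 is Some k then 2 * moment k else 1).
Proof.
move=> mf fA fl1 [um uB us Th0 _ ud].
(* The value 1/2 splits the bound 1 on an indicator evenly between [x] and [y]. *)
pose F (t : L * option L) x : R := if t.2 is Some k then h (x k) else 2^-1.
pose b x := pairing Th (F^~ x).
have iF (t : L * option L) : mu.-integrable setT (EFin \o F t).
  rewrite /F; case: t.2 => [k|]; last exact: finite_measure_integrable_cst.
  have := integrable_affine 0 1 (h_site_meas k) (fun x =>
    h_ge0 (x k)) (tempered_moment_lty k).
  by under [EFin \o _]eq_fun do rewrite add0r mul1r.
have [ib bE] := pairing_integral Th iF; rewrite -/b in ib bE.
pose bb := \int[mu]_x b x.
have -> : pairing Th (fun t => if t.2 is Some k then 2 * moment k else 1) =
    bb + bb.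
  rewrite /bb bE /pairing -big_split/=; apply: eq_bigr => p _;
    rewrite -mulrDr; congr (_ * _).
  rewrite /F; case: p.2.2 => [k|]; first by rewrite -/(moment k) -mulr2n
    mulr_natl.
  rewrite Rintegral_cst// [X in fine X](@probability_setT _ _ _ mu) mulr1.
  by field.
have udb x y : `|u x - u y| <= b x + b y.
  apply: le_trans (ud x y) _; rewrite /b /pairing -big_split/=.
  rewrite big_seq [leRHS]big_seq; apply: ler_sum => -[w t] /Th0/= w0.
  rewrite -mulrDr ler_wpM2l// /influence /F; case: t.2 => [k|].
    by rewrite ler_piMl ?ups_le1// addr_ge0.
  by apply: le_trans (ups_le1 _ _ _) _; lra.
have dom_int (w : config L Xi -> R) (C : R) :
    measurable_fun setT w -> (forall x, 0 <= w x <= C) ->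
    mu.-integrable setT (EFin \o w).
  move=> mw wC; apply: (@integrable_dominated _ _ _ _ _ (cst C)) => //.
    exact: finite_measure_integrable_cst.
  by move=> x; have /andP[? ?] := wC x; rewrite ger0_norm.
have cst_int (C : R) : mu.-integrable setT (EFin \o cst C).
  exact: finite_measure_integrable_cst.
have cstE (C : R) : \int[mu]_x C = C.
  by rewrite Rintegral_cst// [X in fine X](@probability_setT _ _ _ mu) mulr1.
have iu : mu.-integrable setT (EFin \o u) by exact: dom_int uB.
have if_ : mu.-integrable setT (EFin \o f) by exact: dom_int fA.
have f0 x : 0 <= f x by have /andP[] := fA x.
have fA' x : f x <= A by have /andP[] := fA x.
pose ub := \int[mu]_x u x.
have center x : `|u x - ub| <= b x + bb.
  have idiff : mu.-integrable setT (EFin \o (fun y => u x - u y)).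
    exact: (integrableB measurableT (cst_int (u x)) iu).
  have isum : mu.-integrable setT (EFin \o (fun y => b x + b y)).
    exact: (integrableD measurableT (cst_int (b x)) ib).
  have -> : u x - ub = \int[mu]_y (u x - u y).
    by rewrite (RintegralB measurableT (cst_int (u x)) iu) cstE.
  have -> : b x + bb = \int[mu]_y (b x + b y).
    by rewrite (RintegralD measurableT (cst_int (b x)) ib) cstE.
  apply: le_trans (le_normr_Rintegral measurableT idiff) _.
  apply: le_Rintegral => //.
  apply: (integrable_dominated _ isum) => [|y]; last by rewrite normr_id.
  apply: measurableT_comp => //; exact: measurable_funB.
have uE : ub = \int[mu]_x v x.
  (* The constant test function 1 shows that [u] and [v] have the same mean. *)
  have u1 := us (cst 1) 1 (measurable_cst _).
  transitivity (\int[mu]_x (cst 1 x * u x)).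
    by apply: eq_Rintegral => x _; rewrite mul1r.
  rewrite u1//; first by apply: eq_Rintegral => x _; rewrite mul1r.
  by move=> x; rewrite ler01 lexx.
rewrite /Cov -(us f A)// -uE.
have ifu : mu.-integrable setT (EFin \o (fun x => f x * u x)).
  apply: (dom_int _ (A * B)); first exact: measurable_funM.
  move=> x; have /andP[? ?] := uB x; rewrite mulr_ge0//=.
  by apply: ler_pM.
have ifub : mu.-integrable setT (EFin \o (fun x => f x * ub)).
  by under [EFin \o _]eq_fun do rewrite mulrC;
    exact: (integrableZl measurableT ub if_).
have ibb : mu.-integrable setT (EFin \o (fun x => A * (b x + bb))).
  exact: (integrableZl measurableT A (integrableD measurableT ib (cst_int bb))).
rewrite -RintegralZr// -RintegralB//.
have dfE x : `|f x * u x - f x * ub| <= A * (b x + bb).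
  by rewrite -mulrBr normrM ger0_norm//; apply: ler_pM.
have mdf : measurable_fun setT (fun x => f x * u x - f x * ub).
  by apply: measurable_funB; apply: measurable_funM.
have idf := integrable_dominated mdf ibb dfE.
apply: le_trans (le_normr_Rintegral measurableT idf) _.
have -> : A * (bb + bb) = \int[mu]_x (A * (b x + bb)).
  rewrite RintegralZl//; last exact: (integrableD measurableT ib (cst_int bb)).
  by rewrite (RintegralD measurableT ib (cst_int bb)) cstE.
apply: le_Rintegral => //.
apply: (integrable_dominated _ ibb) => [|y]; last by rewrite normr_id.
exact: measurableT_comp.
Qed.

End Covariance.

(** * Contraction rate for [K] above [K_star] *)

Section Constants.
Variables (R : realType) (Delta chi : nat) (kbar cbar K : R).
Hypotheses (Delta1 : (1 <= Delta)%N) (chi2 : (2 <= chi)%N).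
Hypotheses (kbar0 : 0 <= kbar) (kbar1 : kbar < 1) (cbar0 : 0 < cbar).
Hypothesis cbar_lt : cbar < 1 / Delta%:R ^+ chi.
Hypothesis K_gt : K_star Delta chi kbar cbar < K.

Let q : R := cbar * Delta%:R ^+ chi.
Let D : R := Delta%:R.

(* The weight given to the terms involving [h]: with it, the inhomogeneous term
   [2 * Delta ^ chi] amounts to half of the gap [1 - cbar * Delta ^ chi]. *)
Definition moment_ratio : R :=
  4 * Delta%:R ^+ chi / (1 - cbar * Delta%:R ^+ chi).

(** The entries are the factors that a sweep requires for the terms of the first and of the second
    kind when [l] is [moment_ratio * g]; the second lies midway between [cbar * Delta ^ chi] and
    1. *)
Definition contraction_rate : R :=
  Num.max (kbar + K^-1 * (Delta%:R ^+ chi * moment_ratio))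
          ((1 + cbar * Delta%:R ^+ chi) / 2).

Let D1 : 1 <= D. Proof. by rewrite /D ler1n. Qed.

Let Dchi1 : 1 <= D ^+ chi. Proof. exact: exprn_ege1. Qed.

Let Dchi0 : 0 < D ^+ chi. Proof. exact: lt_le_trans Dchi1. Qed.

Let q0 : 0 < q. Proof. exact: mulr_gt0. Qed.

Let q1 : q < 1. Proof. by move: cbar_lt; rewrite ltr_pdivlMr. Qed.

Lemma cbar_lt1 : cbar < 1.
Proof. by apply: le_lt_trans q1; rewrite /q ler_peMr// ltW. Qed.

Lemma moment_ratio_ge1 : 1 <= moment_ratio.
Proof.
rewrite /moment_ratio -/D -/q ler_pdivlMr ?subr_gt0// mul1r.
by move: Dchi1 q0; lra.
Qed.

Lemma moment_ratio_step g :
  Delta%:R ^+ chi * (2 * g + cbar * (moment_ratio * g)) =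
  (1 + cbar * Delta%:R ^+ chi) / 2 * (moment_ratio * g).
Proof.
rewrite /moment_ratio -/D -/q.
have : 1 - q != 0 by rewrite subr_eq0 gt_eqF.
by rewrite /q => ?; field.
Qed.

(** The left side is the value of [K] at which the first entry of [contraction_rate] equals 1. The
    second argument of the maximum in [K_star] exceeds it through one more [1 - kbar <= 1] in the
    denominator and one more nonnegative summand in the numerator. *)
Lemma K_star_lb : 4 * Delta%:R ^+ chi * Delta%:R ^+ chi /
  ((1 - kbar) * (1 - cbar * Delta%:R ^+ chi)) <= K_star Delta chi kbar cbar.
Proof.
rewrite /K_star le_max; apply/orP; right; rewrite -/D -/q.
have k1 : 0 < 1 - kbar by rewrite subr_gt0.
have q1' : 0 < 1 - q by rewrite subr_gt0.
have k1' : 1 - kbar <= 1 by move: kbar0; lra.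
rewrite ler_pdivlMr; last by rewrite mulr_gt0// exprn_gt0.
have -> : 4 * D ^+ chi * D ^+ chi / ((1 - kbar) * (1 - q)) *
    ((1 - kbar) ^+ 2 * (1 - q)) = (1 - kbar) * (4 * (D ^+ chi * D ^+ chi)).
  by field; rewrite !gt_eqF.
have -> : 2 * D ^+ chi.+1 * (2 * D ^+ chi.-1 + 1 - q) =
    4 * (D ^+ chi * D ^+ chi) + 2 * D ^+ chi.+1 * (1 - q).
  rewrite -[in D ^+ chi * D ^+ chi](prednK (ltnW chi2)) !exprS;
    case: chi chi2 => // n _ /=.
  by rewrite !exprS; ring.
have P0 : 0 <= 4 * (D ^+ chi * D ^+ chi) by rewrite !mulr_ge0// ltW.
apply: (@le_trans _ _ (4 * (D ^+ chi * D ^+ chi))); first by rewrite ler_piMl.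
by rewrite lerDl !mulr_ge0 ?exprn_ge0 ?(ltW q1')// (le_trans _ D1).
Qed.

Lemma K_gt0 : 0 < K.
Proof.
apply: le_lt_trans K_gt; apply: le_trans K_star_lb.
by rewrite divr_ge0 ?mulr_ge0 ?subr_ge0 ?(ltW kbar1) ?(ltW q1)// ltW.
Qed.

Lemma contraction_rate_lt1 : contraction_rate < 1.
Proof.
rewrite /contraction_rate gt_max; apply/andP; split; last first.
  by rewrite -/D -/q ltr_pdivrMr//; move: q1; lra.
rewrite -ltrBrDl mulrC ltr_pdivrMr ?K_gt0//.
have k1 : 0 < 1 - kbar by rewrite subr_gt0.
rewrite [ltRHS]mulrC -ltr_pdivrMr//; apply: le_lt_trans K_gt;
  apply: le_trans K_star_lb.
rewrite /moment_ratio -/D -/q le_eqVlt; apply/orP; left; apply/eqP; field.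
by rewrite !gt_eqF// subr_gt0.
Qed.

Lemma contraction_rate_gt0 : 0 < contraction_rate.
Proof.
rewrite /contraction_rate lt_max; apply/orP; right; rewrite -/D -/q.
by rewrite divr_gt0//; move: q0; lra.
Qed.

End Constants.

(** * Distances, the sup-norm, and exponential decay of the covariance *)

Lemma graph_distP (L : countType) (e : rel L) (l1 l2 : L) : connected_graph e ->
  is_least (walk_of_length e l1 l2) (graph_dist e l1 l2).
Proof.
(* Connectedness supplies a walk, so the default value 0 in [graph_dist] is never taken. *)
move=> conn; apply: (@xgetPex _ 0%N [set n | is_least (walk_of_length e l1 l2)
  n]).
have ex : exists n, `[< walk_of_length e l1 l2 n >].
  by have [n wn] := conn l1 l2; exists n; apply/asboolP.
case: (ex_minnP ex) => n /asboolP wn nmin; exists n; split => // k wk.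
by apply: nmin; apply/asboolP.
Qed.

Lemma sup_normP (R : realType) (L : countType) d (Xi : measurableType d)
    (f : config L Xi -> R) x :
  bounded_fun f -> (forall x, 0 <= f x) -> 0 <= f x <= sup_norm f.
Proof.
move=> bf f0; rewrite f0/=; rewrite -[f x]ger0_norm//.
apply: ub_le_sup; last by exists x.
have [M fM] := bounded_fun_has_ubound bf; exists M => _ [y _ <-].
by rewrite ger0_norm//; apply: fM; exists y.
Qed.

(** As [N / k <= n + 1] and [th < 1], [th ^+ n.+1] is at most [th] to the power [N / k]; the
    prefactor [th^-1] pays for the incomplete last block. *)
Lemma expr_le_expR (R : realType) (th : R) (n N k : nat) : 0 < th -> th < 1 ->
  (0 < k)%N -> (N <= n.+1 * k)%N ->
  th ^+ n <= th^-1 * expR (- (- ln th / k%:R * N%:R)).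
Proof.
move=> th0 th1 k0 Nn.
rewrite mulrC ler_pdivlMr// -exprSr -{1}(lnK (_ : th \is Num.pos)) ?posrE//.
rewrite -expRM_natl ler_expR mulNr mulNr opprK mulrAC -mulrA.
have lnth : ln th < 0 by apply: ln_lt0; rewrite th0.
rewrite mulrC ler_nM2l// ler_pdivrMr ?ltr0n// -natrM ler_nat//.
Qed.

Theorem theorem2p7 (R : realType)
    (L : countType) (e : rel L) (Delta chi : nat)
    (d : measure_display) (Xi : measurableType d)
    (h : Xi -> R) (kappa c : L -> L -> R) (kbar cbar : R)
    (e_sym : symmetric e) (e_irr : irreflexive e)
    (e_conn : connected_graph e)
    (e_deg : is_max_degree e Delta) (e_chi : is_chromatic_number e chi)
    (chi_le : (chi <= Delta)%N)
    (Xi_sb : standard_borel R Xi)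
    (h_meas : measurable_fun setT h) (h_ge0 : forall xi, 0 <= h xi)
    (kappa_ge0 : forall l l', 0 <= kappa l l')
    (kbarE : row_sum_sup e kappa = kbar%:E) (kbar_lt1 : kbar < 1)
    (c_ge0 : forall l l', 0 <= c l l')
    (cbarE : row_sum_sup e c = cbar%:E) (cbar_gt0 : 0 < cbar)
    (cbar_lt : cbar < 1 / Delta%:R ^+ chi) :
  forall K : R, K_star Delta chi kbar cbar < K ->
  exists C alpha : R, [/\ 0 < C, 0 < alpha &
    forall pi : L -> config L Xi -> probability Xi R,
      spec_class e h K kappa c pi ->
    forall mu : probability (config L Xi) R, tempered_states pi h mu ->
    forall (l1 l2 : L) (f g : config L Xi -> R), l1 != l2 ->
      bounded_fun f -> bounded_fun g ->
      (forall x, 0 <= f x) -> (forall x, 0 <= g x) ->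
      depends_on_site l1 f -> depends_on_site l2 g ->
      `|Cov mu f g| <= C * sup_norm f * sup_norm g *
                       expR (- (alpha * (graph_dist e l1 l2)%:R))].
Proof.
move=> K K_gt.
pose nb l : seq L := finmap.enum_fset (fset_set (nbrs e l)).
have nb_fin l : finite_set (nbrs e l).
  by apply/finite_set_leP; exists Delta; exact: (proj1 e_deg).
have nbE k i : (i \in nb k) = e k i.
  by apply: (etrans (in_fset_set (nb_fin k) i)); apply/idP/idP; rewrite inE.
have nb_uniq k : uniq (nb k) by exact: finmap.fset_uniq.
have size_nb k : (size (nb k) <= Delta)%N.
  by apply: geq_card_fset_set; exact: (proj1 e_deg).
have row_le (a : L -> L -> R) (s : R) : row_sum_sup e a = s%:E ->
    forall k, \sum_(i <- nb k) a k i <= s.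
  move=> aE k; rewrite -lee_fin -aE -(sum_nbrs nbE nb_uniq).
  by apply: ereal_sup_ubound; exists k.
have kappa_le := row_le _ _ kbarE.
have c_le := row_le _ _ cbarE.
(* Positivity of [cbar] yields an edge, which forces at least two colours. *)
have [k0 [i0 ki0]] : exists k i, e k i.
  apply: contrapT => noedge.
  have : (row_sum_sup e c <= 0)%E.
    apply: ge_ereal_sup => _ [k _ <-]; rewrite lee_fin (sum_nbrs nbE nb_uniq).
    rewrite big_seq big1// => i; rewrite nbE => ki.
    by exfalso; apply: noedge; exists k, i.
  by rewrite cbarE lee_fin leNgt cbar_gt0.
have [[col0 col0P] _] := e_chi.
pose col l : nat := col0 l.
have col_proper k i : e k i -> col k != col i by move=> /col0P.
have col_lt k : (col k < chi)%N by exact: ltn_ord.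
have chi2 : (2 <= chi)%N.
  have := col_proper _ _ ki0; have := col_lt k0; have := col_lt i0.
  by case: (chi) => [|[|]]//; case: (col k0) (col i0) => [|?] [|?].
have Delta1 : (1 <= Delta)%N by apply: leq_trans chi_le; exact: ltnW.
have kbar0 : 0 <= kbar by apply: le_trans (kappa_le k0); apply: sumr_ge0.
have cbar1 := cbar_lt1 Delta1 cbar_gt0 cbar_lt.
have K0 := K_gt0 Delta1 chi2 kbar0 kbar_lt1 cbar_lt K_gt.
pose r := moment_ratio Delta chi cbar.
pose th := contraction_rate Delta chi kbar cbar K.
have th1 : th < 1 :=
  contraction_rate_lt1 Delta1 chi2 kbar0 kbar_lt1 cbar_lt K_gt.
have th0 : 0 < th := contraction_rate_gt0 _ _ _ Delta1 cbar_gt0.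
have r1 : 1 <= r := moment_ratio_ge1 Delta1 cbar_gt0 cbar_lt.
pose M := 1 / (1 - cbar).
have M0 : 0 <= M by rewrite divr_ge0// subr_ge0 ltW.
(* As [M] bounds every moment, [g0] bounds the integrated terms of both kinds, 1 and
   [2 * moment k]. *)
pose g0 := 1 + 2 * M.
have g0_gt0 : 0 < g0 by rewrite ltr_pwDl// mulr_ge0.
have sweep_th g Gam : 0 <= g -> bounded_terms g (r * g) Gam ->
    bounded_terms (th * g) (r * (th * g)) (sweep nb kappa c K col chi Gam).
  move=> gge0; rewrite (mulrCA r); apply: (bounded_terms_sweep (cbar := cbar)
    (kbar := kbar) K0 kappa_ge0 c_ge0 size_nb) => //.
  - by move=> k i; rewrite nbE eq_sym; exact: col_proper.
  - exact: ltW.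
  - by rewrite mulr_ge0// (le_trans _ r1).
  - exact: ltW.
  - rewrite [_ ^+ _ * (r * g)]mulrA mulrA -mulrDl ler_wpM2r//.
    by rewrite /th /contraction_rate le_max lexx.
  - rewrite moment_ratio_step//; apply: ler_wpM2r;
      first by apply: mulr_ge0 => //; exact: le_trans r1.
    by rewrite /th /contraction_rate le_max lexx orbT.
(* A sweep covers [chi] units of distance and gains a factor [th], whence the rate; dividing by [th]
   absorbs the rounding to whole sweeps. Neither value involves [pi] or [mu]. *)
exists (g0 / th), (- ln th / chi%:R); split.
- exact: divr_gt0.
- rewrite divr_gt0 ?ltr0n ?(ltnW chi2)// oppr_gt0; apply: ln_lt0.
  by rewrite th0.
move=> pi piP mu muP l1 l2 f g l12 bf bg f_ge0 g_ge0 [F mF fE] [G mG gE].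
have [mu_cons _] := muP.
have fN x := sup_normP x bf f_ge0; have gN x := sup_normP x bg g_ge0.
have mf : measurable_fun setT f.
  rewrite (_ : f = F \o (fun x => x l1)); last exact/funext.
  exact: measurableT_comp mF (measurable_coord l1).
have mg : measurable_fun setT g.
  rewrite (_ : g = G \o (fun x => x l2)); last exact/funext.
  exact: measurableT_comp mG (measurable_coord l2).
have fl1 (x y : config L Xi) : x l1 = y l1 -> f x = f y by rewrite !fE => ->.
have sg0 : 0 <= sup_norm g.
  by have /andP[a b] := gN point; exact: le_trans a b.
have sf0 : 0 <= sup_norm f.
  by have /andP[a b] := fN point; exact: le_trans a b.
(* The start is [g] itself: its values lie between 0 and [sup_norm g], so a single term at [l2]
   controls its oscillation. *)
have ctl : controlled e h mu l1 l2 (sup_norm g) g 0 g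
    [:: (sup_norm g, (l2, None))].
  split => //.
  - by move=> p; rewrite inE => /eqP ->.
  - by move=> k; rewrite /sites /= inE => /eqP ->; exists 0%N => //;
      exists [::].
  move=> x y; rewrite /pairing big_seq1 /influence /=.
  have [xy|xy] := eqVneq (x l2) (y l2).
    by rewrite !gE xy subrr normr0 mulr_ge0// ups_ge0.
  rewrite ups_neq// mulr1; have /andP[? ?] := gN x; have /andP[? ?] := gN y.
  by rewrite ler_norml; apply/andP; split; lra.
have [walkN leN] := graph_distP l1 l2 e_conn; set N := graph_dist e l1 l2 in
  walkN leN *.
have N0 : (0 < N)%N.
  rewrite lt0n; apply/eqP => N0; move: walkN; rewrite N0.
  by move=> [p [_ pl /size0nil p0]]; move: pl l12; rewrite p0 /= => ->;
    rewrite eqxx.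
(* The largest number of full sweeps that stay within distance [N - 1] of [l2], so that [l1] is
   never averaged over. *)
pose n := (N.-1 %/ chi)%N.
have far : ~ near_site e l2 (n * chi) l1.
  move=> [k kn /leN Nk]; have : (N <= N.-1)%N.
    by apply: leq_trans Nk (leq_trans kn _); exact: leq_divM.
  by rewrite -{1}(prednK N0) ltnn.
have [u ctlu] := controlled_iter_sweep h_meas h_ge0 kappa_ge0 c_ge0 K0 nbE
  nb_uniq e_sym col_proper piP mu_cons ctl far.
apply: le_trans (covariance_le h_meas h_ge0 c_ge0 nbE nb_uniq c_le cbar1 piP
  muP mf fN fl1 ctlu) _.
(* The sweeps are moved from the combination of terms to the integrated values of the terms, where
   they contract. *)
rewrite pairing_iter_sweep_adjoint /pairing big_seq1 /=.
set Gam0 := fun t => _.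
have Gam0P : bounded_terms g0 (r * g0) Gam0.
  split=> [k|k k']; rewrite /Gam0 /=.
    by rewrite ler01 /g0 lerDl mulr_ge0.
  rewrite mulr_ge0 ?moment_ge0//=; apply: (@le_trans _ _ g0).
    apply: (@le_trans _ _ (2 * M)); last by rewrite /g0 lerDr.
    rewrite ler_wpM2l//.
    exact: (moment_le h_meas h_ge0 c_ge0 nbE nb_uniq c_le cbar1 piP muP).
  by rewrite ler_peMl// ltW.
have iterP : bounded_terms (th ^+ n * g0) (r * (th ^+ n * g0))
    (iter n (sweep nb kappa c K col chi) Gam0).
  elim: (n) => [|m IH]; first by rewrite expr0 mul1r.
  by rewrite iterS exprS -mulrA; apply: sweep_th => //;
    rewrite mulr_ge0 ?exprn_ge0 ?ltW.
have /andP[_ le_iter] := proj1 iterP l2.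
have thn : th ^+ n <= th^-1 * expR (- (- ln th / chi%:R * N%:R)).
  apply: expr_le_expR => //; first exact: ltnW.
  by rewrite -(prednK N0) ltn_ceil// ltnW.
rewrite [leRHS](_ : _ = sup_norm f * (sup_norm g *
  (th^-1 * expR (- (- ln th / chi%:R * N%:R)) * g0))); last by ring.
rewrite ler_wpM2l// ler_wpM2l//; apply: le_trans le_iter _.
by rewrite ler_wpM2r// ltW.
Qed.
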